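(* Let $0<a\le b\le2$ and let $\alpha:\mathbb{R}\to[a,b]$ be continuous. For each $n\in\mathbb{N}$ define $\alpha_n:\mathbb{R}\to[a,b]$ by $\alpha_n(x)=\alpha(r2^{-n})$ if $x\in[r2^{-n},(r+1)2^{-n})$, $r\in\mathbb{Z}$, and let $M_{\alpha_n}$ and $M_\alpha$ be the $\alpha_n(x)$-multistable and $\alpha(x)$-multistable measures. For $r\in\mathbb{Z}$ let $M_{n,r}$ denote the restriction of $\alpha(r2^{-n})$-stable measure to the interval $[r2^{-n},(r+1)2^{-n})$, that is $$M_{n,r}(A)=M_{\alpha_n}\big(A\cap[r2^{-n},(r+1)2^{-n})\big),\qquad A\in\mathcal{E}_0.$$ Then for each $n$ the random measure $M_{\alpha_n}$ is given by the independent sum of random measures (i.e. the random measures $M_{n,r}$, $r\in\mathbb{Z}$, are independent) $$M_{\alpha_n}(A)=\sum_{r\in\mathbb{Z}}M_{n,r}(A)$$ almost surely, for each $A\in\mathcal{E}_0$. Moreover, $M_{\alpha_n}\to M_\alpha$ in finite-dimensional distributions as $n\to\infty$, that is, for all $m\in\mathbb{N}$ and $A_1,\dots,A_m\in\mathcal{E}_0$, $(M_{\alpha_n}(A_1),\dots,M_{\alpha_n}(A_m))\to(M_\alpha(A_1),\dots,M_\alpha(A_m))$ in distribution.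
   Context: Let $\mathcal{E}_0$ be the collection of Lebesgue measurable subsets of $\mathbb{R}$ of finite Lebesgue measure. For measurable $\alpha:\mathbb{R}\to[a,b]$ with $0<a\le b\le2$, let $\mathcal{F}_\alpha$ be the space of measurable $f:\mathbb{R}\to\mathbb{R}$ with $\int|f(x)|^{\alpha(x)}dx<\infty$. The $\alpha(x)$-multistable integral is a stochastic process $\{I(f):f\in\mathcal{F}_\alpha\}$ with $$\mathbb{E}\Big(\exp i\sum_{j=1}^d\theta_jI(f_j)\Big)=\exp\Big\{-\int\Big|\sum_{j=1}^d\theta_jf_j(x)\Big|^{\alpha(x)}dx\Big\}$$ for all $d\in\mathbb{N}$, $f_1,\dots,f_d\in\mathcal{F}_\alpha$, $\theta_1,\dots,\theta_d\in\mathbb{R}$ (such a process exists), and the $\alpha(x)$-multistable measure is $M_\alpha(A)=I(\mathbf{1}_A)$, $A\in\mathcal{E}_0$. When $\alpha(x)\equiv\alpha_0$ is constant, $M_{\alpha_0}$ is the ($\alpha_0$-)stable measure. Since $\alpha_n$ equals the constant $\alpha(r2^{-n})$ on $[r2^{-n},(r+1)2^{-n})$, the family $A\mapsto M_{\alpha_n}(A\cap[r2^{-n},(r+1)2^{-n}))$ has the same finite-dimensional distributions as $A\mapsto M_{\alpha(r2^{-n})}(A\cap[r2^{-n},(r+1)2^{-n}))$, where $M_{\alpha(r2^{-n})}$ is $\alpha(r2^{-n})$-stable measure. Two or more random measures are independent if the corresponding families of random variables indexed by $\mathcal{E}_0$ are independent. *)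

(* Defs.v *)
From HB Require Import structures.
From mathcomp Require Import all_boot all_order all_algebra finmap.
From mathcomp Require Import complex.
From mathcomp Require Import all_classical all_reals all_analysis.

Set Implicit Arguments.
Unset Strict Implicit.
Unset Printing Implicit Defensive.

Import Order.TTheory GRing.Theory Num.Theory.
Import numFieldNormedType.Exports.

Local Open Scope classical_set_scope.
Local Open Scope ring_scope.

(* The real line with the sigma-algebra of all Lebesgue (not just Borel)
   measurable sets, i.e. the domain of [completed_lebesgue_measure]. *)
Notation lebesgueType R := (caratheodory_type (@wlength R idfun)^*%mu).

Notation leb R := (@completed_lebesgue_measure R).

Definition finite_lebesgue {R : realType} : set (set R) :=
  [set A | measurable (A : set (lebesgueType R)) /\ (leb R A < +oo)%E].

Definition multistable_space {R : realType} (alpha : R -> R) : set (R -> R) :=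
  [set f | measurable_fun [set: lebesgueType R] (f : lebesgueType R -> R) /\
           (\int[leb R]_x (`|f x| `^ alpha x)%:E < +oo)%E].

(* exp(i x) *)
Definition expi {R : realType} (x : R) : R[i] := (cos x +i* sin x)%C.

Definition cexpectation {R : realType} d (Omega : measurableType d)
    (P : probability Omega R) (Z : Omega -> R[i]) : R[i] :=
  (fine 'E_P[fun w => complex.Re (Z w)] +i*
   fine 'E_P[fun w => complex.Im (Z w)])%C.

(* The process is indexed by all functions for convenience: the values
   outside [multistable_space alpha] are unconstrained and never used.
   For alpha with values in [a, b], 0 < a <= b, [multistable_space alpha] is
   stable under linear combinations, so the real-valued integral below is that
   of an integrable function. *)
Definition is_multistable_integral {R : realType} d (Omega : measurableType d)
    (P : probability Omega R) (alpha : R -> R)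
    (I : (R -> R) -> {RV P >-> R}) : Prop :=
  forall (k : nat) (f : 'I_k -> R -> R) (theta : 'I_k -> R),
    (forall j, multistable_space alpha (f j)) ->
    cexpectation P (fun w => expi (\sum_(j < k) theta j * I (f j) w)) =
    (expR (- \int[leb R]_x
        (`|\sum_(j < k) theta j * f j x| `^ alpha x)))%:C%C.

Definition multistable_measure {R : realType} d (Omega : measurableType d)
    (P : probability Omega R) (I : (R -> R) -> {RV P >-> R})
    (A : set R) : {RV P >-> R} := I \1_A.

Definition dyadic_interval {R : realType} (n : nat) (r : int) : set R :=
  [set x : R | r%:~R / 2 ^+ n <= x < (r + 1)%:~R / 2 ^+ n].

Definition restrict_measure {R : realType} d (Omega : measurableType d)
    (P : probability Omega R) (M : set R -> {RV P >-> R}) (B A : set R) :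
    {RV P >-> R} := M (A `&` B).

Definition generated_sigma {R : realType} d (Omega : measurableType d)
    (P : probability Omega R) (J : Type) (D : set J) (X : J -> {RV P >-> R}) :
    set (set Omega) :=
  <<s [set X j @^-1` B | j in D & B in (measurable : set (set R))] >>.

(* Mutual independence of a (possibly infinite) collection of families of
   random variables, through the sigma-algebras that they generate. *)
Definition independent_families {R : realType} d (Omega : measurableType d)
    (P : probability Omega R) (K : choiceType) (J : Type) (D : set J)
    (X : K -> J -> {RV P >-> R}) : Prop :=
  forall (S : {fset K}) (E : K -> set Omega),
    (forall i, i \in S -> generated_sigma D (X i) (E i)) ->
    P (\bigcap_(i in [set` S]) E i) = (\prod_(i <- S) P (E i))%E.

Definition independent_measures {R : realType} d (Omega : measurableType d)
    (P : probability Omega R) (K : choiceType)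
    (M : K -> set R -> {RV P >-> R}) : Prop :=
  independent_families finite_lebesgue M.

(* Two-sided series: the partial sums over -p <= r < q converge to s as p and
   q tend to infinity independently of each other. *)
Definition zseries_cvg_to {R : realType} (u : int -> R) (s : R) : Prop :=
  (\sum_(0 <= k < pq.1) u (- (k.+1)%:Z) + \sum_(0 <= k < pq.2) u k%:Z)
    @[pq --> filter_prod \oo \oo] --> s.

Definition cvg_in_distribution {R : realType} (m : nat)
    (dn : nat -> measure_display) (Omegan : forall n, measurableType (dn n))
    (Pn : forall n, probability (Omegan n) R)
    (d : measure_display) (Omega : measurableType d) (P : probability Omega R)
    (Xn : forall n, Omegan n -> 'rV[R]_m) (X : Omega -> 'rV[R]_m) : Prop :=
  forall g : 'rV[R]_m -> R, continuous g ->
    (exists C : R, forall v, `|g v| <= C) ->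
    ('E_(Pn n)[g \o Xn n] @[n --> \oo] --> 'E_P[g \o X])%E.

(* Main.v *)
Require Import Defs.
From mathcomp Require Import all_boot all_order all_algebra finmap.
From mathcomp Require Import all_classical all_reals all_analysis.
From mathcomp Require Import measurable_realfun ring lra.
Import Order.TTheory GRing.Theory Num.Theory.
Import numFieldNormedType.Exports.
Set Implicit Arguments.
Unset Strict Implicit.
Unset Printing Implicit Defensive.
Local Open Scope classical_set_scope.
Local Open Scope ring_scope.

(** A multistable measure M is known only through the characteristic functions
of its finite linear combinations: the one of sum_j theta_j M(A_j) at 1 is
exp(-J(s)), where s = sum_j theta_j 1_{A_j} is a step function and J(s) is the
integral of |s|^alpha.  All the assertions are read off from J.

Independence.  J is additive on functions with disjoint supports, so the joint
characteristic function of values of M on subsets of B and on subsets of the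
complement of B factorizes ([trig_uncorrelated_disjoint]).  This says that all
trigonometric polynomials of the two random vectors are uncorrelated.  The
indicator of a box is a pointwise limit of uniformly bounded trigonometric
polynomials ([trig_poly_limit], [box_ramp_cvg]), hence boxes are independent
events, and so are the sigma-algebras that they generate by the pi-lambda
theorem ([indep_generated], [indep_disjoint]).  Splitting off one dyadic
interval at a time gives the mutual independence ([independent_dyadic]).

The series.  The combination M(A u B) - M(A) - M(B), with A and B disjoint, has
J = 0, so it vanishes almost surely: M is finitely additive ([multistable_setU]).
For the remainders M(D_n) of a disjoint union, D_n decreases to the empty set,
and M(D_n) tends to 0 in probability because J is small on small sets.  The
independence of the pieces upgrades this to almost sure convergence through the
maximal inequality of Ottaviani ([ottaviani], [sup_large_le]).

Convergence.  The exponents alpha_n tend to alpha pointwise by continuity, so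
the functionals J converge by dominated convergence ([power_integral_cvg]) and
the characteristic functions converge.  The continuity theorem of Levy
([levy_continuity]) turns this into convergence in distribution.

Fourier inversion is avoided.  Put p_j(x) = (1 + sin(x_j / K)) / 2.  On the cube
|x_j| <= K a continuous function of x is a continuous function of p(x), and its
Bernstein polynomials in p(x) are trigonometric polynomials in x which converge
uniformly on the cube and stay below the bound of the function everywhere
([trig_approx]).  Tightness is obtained from an explicit bound on tails by sums
of values of the characteristic function along a geometric sequence
([tail_le]). *)

(** * Bernstein operators on the cube *)

(** The mean of f at the end of a random walk which starts at s and, for each j
in l, jumps by h in the direction j with probability p_j.  For l listing each
direction N times and h = 1/N this is the Bernstein polynomial of f at p; the
recursive form makes positivity and polynomiality in p immediate. *)
Fixpoint bern {R : realType} (m : nat) (p : 'rV[R]_m) (h : R) (l : seq 'I_m)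
    (f : 'rV[R]_m -> R) (s : 'rV[R]_m) : R :=
  if l is j :: l' then
    p ord0 j * bern p h l' f (s + h *: delta_mx ord0 j) +
    (1 - p ord0 j) * bern p h l' f s
  else f s.

Definition in_cube {R : realType} (m : nat) (p : 'rV[R]_m) : Prop :=
  forall j, 0 <= p ord0 j <= 1.

Section bernstein.
Context {R : realType} (m : nat).
Implicit Types (p s : 'rV[R]_m) (h c : R) (l : seq 'I_m) (f g : 'rV[R]_m -> R).

Lemma bern_le p h l f g s : in_cube p -> (forall x, f x <= g x) ->
  bern p h l f s <= bern p h l g s.
Proof.
move=> p01 fg; elim: l s => [|j l IH] s //=.
have /andP[p0 p1] := p01 j.
by apply: lerD; apply: ler_wpM2l => //; rewrite subr_ge0.
Qed.

Lemma bern_cst p h l c s : bern p h l (cst c) s = c.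
Proof. by elim: l s => [|j l IH] s //=; rewrite !IH; ring. Qed.

Lemma bern_lin p h l c f g s :
  bern p h l (fun x => c * f x + g x) s = c * bern p h l f s + bern p h l g s.
Proof. by elim: l s => [|j l IH] s //=; rewrite !IH; ring. Qed.

Lemma bern_sum p h l (f : 'I_m -> 'rV[R]_m -> R) s :
  bern p h l (fun x => \sum_i f i x) s = \sum_i bern p h l (f i) s.
Proof.
elim: l s => [|j l IH] s //=.
by rewrite !IH !mulr_sumr -big_split.
Qed.

(** Mean and variance add up along the independent jumps of the walk. *)
Lemma bern_sqr p h l i c s :
  bern p h l (fun x => (x ord0 i - c) ^+ 2) s =
  (s ord0 i + (count_mem i l)%:R * h * p ord0 i - c) ^+ 2 +
  (count_mem i l)%:R * h ^+ 2 * (p ord0 i * (1 - p ord0 i)).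
Proof.
elim: l s => [|j l IH] s //=.
  by rewrite mul0r !mul0r !addr0.
rewrite !IH !mxE eqxx /= natrD.
have [->|ji] := eqVneq j i; rewrite ?eqxx /=.
  by ring.
by rewrite mulr0 addr0 add0r; ring.
Qed.

Lemma bern_norm_le p h l f c s : in_cube p -> (forall x, `|f x| <= c) ->
  `|bern p h l f s| <= c.
Proof.
move=> p01 fc; rewrite ler_norml; apply/andP; split.
  rewrite -[leLHS](bern_cst p h l _ s); apply: bern_le => // x.
  by have := fc x; rewrite ler_norml => /andP[].
rewrite -[leRHS](bern_cst p h l _ s); apply: bern_le => // x.
by have := fc x; rewrite ler_norml => /andP[].
Qed.

(** Chebyshev's argument: off the event that some coordinate of the walk is d
away from its mean, G varies by at most e / 2, and a walk with N jumps of length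
1/N in each direction has variance at most 1/N. *)
Lemma bern_approx (G : 'rV[R]_m -> R) (C : R) :
  (forall x, `|G x| <= C) ->
  (forall e : R, 0 < e -> exists2 d : R, 0 < d & forall x y : 'rV[R]_m,
     (forall j, `|x ord0 j - y ord0 j| < d) -> `|G x - G y| < e) ->
  forall e : R, 0 < e -> exists h l, forall p, in_cube p ->
    `|bern p h l G 0 - G p| <= e.
Proof.
move=> GC Gu e e0.
have e20 : 0 < e / 2 by rewrite divr_gt0.
have [d d0 Gd] := Gu _ e20.
have C0 : 0 <= C by apply: le_trans (GC 0).
(* 2 C is the largest error, paid only if (x_j - p_j)^2 >= d^2 for some j *)
pose K := 2 * C / d ^+ 2.
have K0 : 0 <= K by rewrite divr_ge0 ?sqr_ge0// mulr_ge0.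
pose N := (Num.bound (K * m%:R / (e / 2))).+1.
have N0 : (0 : R) < N%:R by rewrite ltr0n.
have KN : K * m%:R / N%:R <= e / 2.
  rewrite ler_pdivrMr// [leRHS]mulrC -ler_pdivrMr//.
  apply: (@le_trans _ _ (Num.bound (K * m%:R / (e / 2)))%:R).
    by apply/ltW/archi_boundP; rewrite divr_ge0 ?(ltW e20)// mulr_ge0.
  by rewrite ler_nat.
exists (N%:R^-1), (flatten (nseq N (enum 'I_m))) => p p01.
have cN i : count_mem i (flatten (nseq N (enum 'I_m))) = N.
  elim: N {N0 KN} => //= n IH; rewrite count_cat IH count_uniq_mem ?enum_uniq//.
  by rewrite mem_enum.
set l := flatten _ in cN *; set h := N%:R^-1.
pose Q (x : 'rV[R]_m) := \sum_i (x ord0 i - p ord0 i) ^+ 2.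
have Q0 x : 0 <= Q x by apply: sumr_ge0 => i _; exact: sqr_ge0.
have GQ x : `|G x - G p| <= K * Q x + e / 2.
  have [xd|] := pselect (forall j, `|x ord0 j - p ord0 j| < d).
    by rewrite (le_trans (ltW (Gd _ _ xd)))// lerDr mulr_ge0.
  move=> /existsNP[j /negP]; rewrite -leNgt => dj.
  apply: (@le_trans _ _ (2 * C)).
    by rewrite (le_trans (ler_normB _ _))// mulr_natl mulr2n lerD.
  rewrite -[leLHS]addr0 lerD// ?(ltW e20)//.
  rewrite -(@divfK _ (d ^+ 2) _ (2 * C)); last by rewrite gt_eqF// exprn_gt0.
  rewrite ler_wpM2l//.
  apply: (@le_trans _ _ ((x ord0 j - p ord0 j) ^+ 2)).
    by rewrite -[leRHS]real_normK ?num_real// ler_pXn2r ?nnegrE// ltW.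
  rewrite /Q (bigD1 j)//= lerDl; apply: sumr_ge0 => i _; exact: sqr_ge0.
have BQ : K * bern p h l Q 0 + e / 2 <= e.
  rewrite [leRHS]splitr lerD2r (le_trans _ KN)// -mulrA ler_wpM2l//.
  have -> : m%:R / N%:R = \sum_(i < m) h.
    by rewrite sumr_const card_ord mulr_natl.
  rewrite bern_sum; apply: ler_sum => i _.
  have Nh : N%:R * h = 1 by rewrite mulfV// gt_eqF.
  rewrite bern_sqr cN mxE add0r expr2 (mulrA N%:R) Nh !mul1r subrr mul0r add0r.
  rewrite -[leRHS]mulr1 ler_wpM2l ?invr_ge0 ?(ltW N0)//.
  have /andP[p0 p1] := p01 i.
  by rewrite mulr_ile1 ?subr_ge0// gerBl.
have Gb : bern p h l (fun x => 1 * G x + cst (- G p) x) 0 =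
    bern p h l G 0 - G p by rewrite bern_lin mul1r bern_cst.
have Qb c : bern p h l (fun x => K * Q x + cst c x) 0 =
  K * bern p h l Q 0 + c by rewrite bern_lin bern_cst.
apply: le_trans BQ; rewrite -Qb -Gb ler_norml; apply/andP; split; last first.
  apply: bern_le => // x; rewrite mul1r /=.
  by rewrite (le_trans (ler_norm _))// GQ.
have Nb f : - bern p h l f 0 = bern p h l (fun x => -1 * f x + cst 0 x) 0.
  by rewrite bern_lin bern_cst mulN1r addr0.
rewrite Nb; apply: bern_le => // x; rewrite mul1r /= addr0 mulN1r lerNl.
by rewrite (le_trans _ (GQ x))// -normrN ler_norm.
Qed.

End bernstein.

(** * Trigonometric polynomials *)

Definition dot {R : realType} (m : nat) (t x : 'rV[R]_m) : R :=
  \sum_(j < m) t ord0 j * x ord0 j.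

Inductive trig_poly {R : realType} (m : nat) : ('rV[R]_m -> R) -> Prop :=
| trig_cos t : trig_poly (fun x => cos (dot t x))
| trig_sin t : trig_poly (fun x => sin (dot t x))
| trig_add S T : trig_poly S -> trig_poly T -> trig_poly (fun x => S x + T x)
| trig_scale c T : trig_poly T -> trig_poly (fun x => c * T x).

Section trig_poly.
Context {R : realType} (m : nat).
Implicit Types (t u x : 'rV[R]_m) (S T : 'rV[R]_m -> R).

Lemma dotDl t u x : dot (t + u) x = dot t x + dot u x.
Proof.
by rewrite /dot -big_split/=; apply: eq_bigr => j _; rewrite mxE mulrDl.
Qed.

Lemma dotNl t x : dot (- t) x = - dot t x.
Proof.
by rewrite /dot -sumrN; apply: eq_bigr => j _; rewrite mxE mulNr.
Qed.

Lemma dot0l x : dot 0 x = 0.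
Proof. by rewrite /dot big1// => j _; rewrite mxE mul0r. Qed.

Lemma eq_trig_poly S T : trig_poly S -> S =1 T -> trig_poly T.
Proof. by move=> + /funext <-. Qed.

Lemma trig_cst c : trig_poly (cst c : 'rV[R]_m -> R).
Proof.
apply: eq_trig_poly (trig_scale c (trig_cos 0)) _ => x /=.
by rewrite dot0l cos0 mulr1.
Qed.

(** By the product-to-sum formulas. *)
Lemma trig_mul S T : trig_poly S -> trig_poly T ->
  trig_poly (fun x => S x * T x).
Proof.
move=> tS; move: S tS T.
apply: trig_poly_ind => [t|t|S S' _ IH _ IH'|c S _ IH] T tT.
- elim: tT => [u|u|T1 T2 _ IH1 _ IH2|c T' _ IH].
  + apply: eq_trig_poly (trig_scale (1/2)
      (trig_add (trig_cos (t + u)) (trig_cos (t - u)))) _ => x /=.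
    by rewrite !dotDl dotNl cosB cosD; field.
  + apply: eq_trig_poly (trig_scale (1/2)
      (trig_add (trig_sin (t + u)) (trig_scale (-1) (trig_sin (t - u))))) _ => x /=.
    by rewrite !dotDl dotNl sinB sinD; field.
  + by apply: eq_trig_poly (trig_add IH1 IH2) _ => x /=; rewrite mulrDr.
  + by apply: eq_trig_poly (trig_scale c IH) _ => x /=; rewrite mulrCA.
- elim: tT => [u|u|T1 T2 _ IH1 _ IH2|c T' _ IH].
  + apply: eq_trig_poly (trig_scale (1/2)
      (trig_add (trig_sin (t + u)) (trig_sin (t - u)))) _ => x /=.
    by rewrite !dotDl dotNl sinB sinD; field.
  + apply: eq_trig_poly (trig_scale (1/2)
      (trig_add (trig_cos (t - u)) (trig_scale (-1) (trig_cos (t + u))))) _ => x /=.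
    by rewrite !dotDl dotNl cosB cosD; field.
  + by apply: eq_trig_poly (trig_add IH1 IH2) _ => x /=; rewrite mulrDr.
  + by apply: eq_trig_poly (trig_scale c IH) _ => x /=; rewrite mulrCA.
- by apply: eq_trig_poly (trig_add (IH _ tT) (IH' _ tT)) _ => x; rewrite mulrDl.
- by apply: eq_trig_poly (trig_scale c (IH _ tT)) _ => x; rewrite mulrA.
Qed.

(** Probabilities that are trigonometric polynomials in x and determine x on the
cube of half-side K. *)
Definition sin_coord (K : R) x : 'rV[R]_m :=
  \row_j ((1 + sin (x ord0 j / K)) / 2).

Lemma in_cube_sin_coord K x : in_cube (sin_coord K x).
Proof.
move=> j; rewrite mxE.
have := sin_geN1 (x ord0 j / K); have := sin_le1 (x ord0 j / K).
by move=> ? ?; apply/andP; split; lra.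
Qed.

(** A Bernstein polynomial evaluated at trigonometric polynomials. *)
Lemma trig_bern K h l (G : 'rV[R]_m -> R) s :
  trig_poly (fun x => bern (sin_coord K x) h l G s).
Proof.
have tX j : trig_poly (fun x => sin_coord K x ord0 j).
  apply: eq_trig_poly (trig_add (trig_cst (1/2))
    (trig_scale (1/2) (trig_sin (K^-1 *: delta_mx ord0 j)))) _ => x /=.
  rewrite mxE; have -> : dot (K^-1 *: delta_mx ord0 j) x = x ord0 j / K.
    rewrite /dot (bigD1 j)//= big1 ?addr0.
      by rewrite !mxE !eqxx mulr1 mulrC.
    by move=> i ij; rewrite !mxE eqxx/= (negbTE ij) mulr0 mul0r.
  by field.
elim: l s => [|j l IH] s /=; first exact: trig_cst.
apply: trig_add; apply: trig_mul => //.
apply: eq_trig_poly (trig_add (trig_cst 1) (trig_scale (-1) (tX j))) _ => x /=.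
by rewrite mulN1r.
Qed.

End trig_poly.

(** * Uniform approximation by trigonometric polynomials *)

Section clip.
Context {R : realType}.
Implicit Types c x y : R.

(** The projection of the line on the segment [-c, c]. *)
Definition clip (c y : R) : R := Num.max (- c) (Num.min c y).

Lemma clip_norm c y : 0 <= c -> `|clip c y| <= c.
Proof.
move=> c0; rewrite /clip ler_norml le_max lexx/= ge_max ge_min lexx/= andbT.
by rewrite ge0_cp.
Qed.

Lemma clip_id c y : `|y| <= c -> clip c y = y.
Proof.
by rewrite ler_norml => /andP[cy yc]; rewrite /clip min_r// max_r.
Qed.

Lemma clip_continuous c : continuous (clip c).
Proof.
move=> y; apply: (@continuous_max _ _ (cst (- c)) (Num.min c)).
  exact: cvg_cst.
by apply: (@continuous_min _ _ (cst c) id); [exact: cvg_cst|exact: cvg_id].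
Qed.

Lemma clip_lip c x y : `|clip c x - clip c y| <= `|x - y|.
Proof.
wlog xy : x y / x <= y.
  by case: (leP x y) => [|/ltW] xy H; [exact: H|rewrite distrC [leRHS]distrC; exact: H].
rewrite [leRHS]distrC (ger0_norm (_ : 0 <= y - x)) ?subr_ge0//.
rewrite /clip ler_norml /Num.max /Num.min.
by do ! case: ifPn; rewrite -?leNgt => *; apply/andP; split; lra.
Qed.

End clip.

Section trig_approx.
Context {R : realType} (m : nat).

Lemma compact_unif_continuous (K : set 'rV[R]_m) (g : 'rV[R]_m -> R) :
  compact K -> continuous g ->
  forall e : R, 0 < e -> exists2 d : R, 0 < d &
    forall x y, K x -> ball x d y -> `|g x - g y| < e.
Proof.
move=> /compact_near_coveringP cK cg e e0.
pose Q (d : R) x := forall y, ball x d y -> `|g x - g y| < e.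
have KQ : \forall d \near 0^'+, K `<=` Q d.
  have := cK R (0^'+) Q _; apply => x Kx.
  have e20 : 0 < e / 2 by rewrite divr_gt0.
  have /nbhs_ballP[d /= d0 dg] : nbhs x [set y | `|g x - g y| < e / 2].
    by have /cvgrPdist_lt := cg x; apply.
  exists (ball x (d / 2), [set r : R | 0 < r < d / 2]).
    split; first by apply: nbhsx_ballx; rewrite divr_gt0.
    have d20 : 0 < d / 2 by rewrite divr_gt0.
    apply: filterS (filterI (nbhs_right_gt 0) (nbhs_right_lt d20)) => r [r0 rd].
    exact/andP.
  move=> [y r] /= [xy /andP[r0 rd]] z yz.
  have gy : `|g x - g y| < e / 2.
    apply: dg; apply: le_ball xy.
    by rewrite ler_pdivrMr// mulr2n mulrDr mulr1 lerDl ltW.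
  have gz : `|g x - g z| < e / 2.
    apply: dg; rewrite (splitr d); apply: ball_triangle xy _.
    exact: le_ball (ltW rd) _ yz.
  rewrite [e]splitr (_ : g y - g z = (g x - g z) - (g x - g y)); last by ring.
  by rewrite (le_lt_trans (ler_normB _ _))// ltrD.
have [d [d0 dKQ]] := filter_ex (filterI (nbhs_right_gt 0) KQ).
by exists d => // x y Kx; exact: dKQ.
Qed.

Lemma row_continuous (f : 'I_m -> R -> R) : (forall j, continuous (f j)) ->
  continuous (fun x : 'rV[R]_m => \row_j f j (x ord0 j)).
Proof.
move=> cf x A /nbhs_ballP[e /= e0 eA].
have H j : nbhs (x : 'rV[R]_m)
    [set y : 'rV[R]_m | ball (f j (x ord0 j)) e (f j (y ord0 j))].
  have /cvg_ballP : (fun y : 'rV[R]_m => f j (y ord0 j)) @ x --> f j (x ord0 j).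
    apply: (@continuous_comp _ _ _ (fun y : 'rV[R]_m => y ord0 j) (f j)).
      exact: coord_continuous.
    exact: cf.
  exact.
suff HA : nbhs (x : 'rV[R]_m) [set y : 'rV[R]_m | A (\row_j f j (y ord0 j))] by exact: HA.
apply: (@filterS _ _ (nbhs_filter (x : 'rV[R]_m)) _ _ _ (filter_forall _ H)) => y fy.
by apply: eA; split => // i j; rewrite !mxE; exact: fy.
Qed.

(** Recovering x from its sine coordinates by a continuous map defined on the
whole space transports g to a function G on the cube of probabilities, to which
the Bernstein approximation applies.  The bound C survives outside the cube
because Bernstein operators are averages. *)
Lemma trig_approx (g : 'rV[R]_m -> R) (C K e : R) :
  continuous g -> (forall x, `|g x| <= C) -> 0 < K -> 0 < e ->
  exists T : 'rV[R]_m -> R, [/\ trig_poly T, forall x, `|T x| <= C &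
    forall x : 'rV[R]_m, (forall j, `|x ord0 j| <= K) -> `|T x - g x| <= e].
Proof.
move=> cg gC K0 e0.
(* |x_j / K| <= 1 on the cube, so clipping at sin 1 < 1 changes nothing there
   and keeps the argument of asin in the open interval where it is continuous *)
pose s1 : R := sin 1.
have s10 : 0 < s1.
  rewrite sin_gt0_pi// ltr01/=.
  by apply: (lt_le_trans _ (@pi_ge2 R)); rewrite ltr1n.
have s11 : s1 < 1.
  rewrite lt_neqAle sin_le1 andbT; apply/eqP => s1E.
  have : cos (1 : R) = 0 by apply: sin1cos0; rewrite -/s1 s1E normr1.
  by apply/eqP; rewrite gt_eqF// cos1_gt0.
pose phi (y : R) := K * asin (clip s1 (2 * y - 1)).
pose G (x : 'rV[R]_m) : R := g (\row_j phi (x ord0 j)).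
pose cl (x : 'rV[R]_m) : 'rV[R]_m := \row_j clip 1 (x ord0 j).
have cphi : continuous phi.
  move=> y; apply: (@continuousM _ _ (cst K)); first exact: cvg_cst.
  apply: (@continuous_comp _ _ _ (fun y : R => clip s1 (2 * y - 1)) asin).
    apply: (@continuous_comp _ _ _ (fun y : R => 2 * y - 1) (clip s1)).
      apply: continuousB; last exact: cvg_cst.
      by apply: continuousM; [exact: cvg_cst|exact: cvg_id].
    exact: clip_continuous.
  apply: continuous_asin; rewrite -ltr_norml.
  by apply: le_lt_trans s11; apply: clip_norm; exact: ltW.
have cG : continuous G.
  move=> x; apply: (@continuous_comp _ _ _
    (fun x : 'rV[R]_m => \row_j phi (x ord0 j)) g); last exact: cg.
  exact: (@row_continuous (fun=> phi)).
have cK : compact [set x : 'rV[R]_m | forall j, `[(- 1 : R), 1]%classic (x ord0 j)].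
  by apply: (@rV_compact _ _ (fun=> `[(- 1 : R), 1]%classic)) => _; exact: segment_compact.
have [||h [l bG]] := @bern_approx _ _ (G \o cl) C _ _ _ e0.
- by move=> x; exact: gC.
- move=> r r0; have [d d0 dG] := compact_unif_continuous cK cG r0.
  exists d => // x y xy; apply: dG => /=.
    move=> j; rewrite mxE /= in_itv/= -ler_norml; exact: clip_norm.
  split=> // i j; rewrite !mxE ord1; apply: le_lt_trans (xy j).
  exact: clip_lip.
exists (fun x => bern (sin_coord K x) h l (G \o cl) 0); split.
- exact: trig_bern.
- by move=> x; apply: bern_norm_le; [exact: in_cube_sin_coord|move=> y; exact: gC].
- move=> x xK; suff <- : (G \o cl) (sin_coord K x) = g x.
    by apply: bG; exact: in_cube_sin_coord.
  rewrite /G /=; congr (g _); apply/rowP => j; rewrite !mxE /phi.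
  have xK1 : `|x ord0 j / K| <= 1.
    by rewrite normrM normfV (gtr0_norm K0) ler_pdivrMr ?mul1r.
  have /andP[c0 c1] := in_cube_sin_coord K x j.
  rewrite mxE in c0 c1.
  rewrite [clip 1 _]clip_id; last by rewrite ger0_norm.
  rewrite mulrC (_ : 2 * _ - 1 = sin (x ord0 j / K)); last by field.
  have pi1 := @pihalf_ge1 R.
  rewrite clip_id; first rewrite sinK ?divfK ?gt_eqF//.
    by rewrite in_itv/= -ler_norml (le_trans xK1).
  move: xK1; rewrite !ler_norml => /andP[x1 x2].
  by rewrite -sinN !leNgt !ltr_sin ?in_itv/= -?leNgt ?x1 ?x2//; apply/andP; split; lra.
Qed.

End trig_approx.

(** * Means of bounded measurable functions *)

Definition bounded_measurable {R : realType} d (T : measurableType d)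
    (f : T -> R) : Prop :=
  measurable_fun [set: T] f /\ exists C : R, forall w, `|f w| <= C.

Definition mean {R : realType} d (T : measurableType d) (P : probability T R)
    (f : T -> R) : R := \int[P]_w f w.

Section mean.
Context {R : realType} d (T : measurableType d) (P : probability T R).
Implicit Types f g : T -> R.

Lemma fine_expectation f : fine 'E_P[f] = mean P f.
Proof. by rewrite unlock. Qed.

Lemma bm_cst c : bounded_measurable (cst c : T -> R).
Proof. by split; [exact: measurable_cst|exists `|c|]. Qed.

Lemma bm_add f g : bounded_measurable f -> bounded_measurable g ->
  bounded_measurable (fun w => f w + g w).
Proof.
move=> [mf [C fC]] [mg [D gD]]; split; first exact: measurable_funD.
by exists (C + D) => w; rewrite (le_trans (ler_normD _ _))// lerD.
Qed.

Lemma bm_mul f g : bounded_measurable f -> bounded_measurable g ->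
  bounded_measurable (fun w => f w * g w).
Proof.
move=> [mf [C fC]] [mg [D gD]]; split; first exact: measurable_funM.
by exists (C * D) => w; rewrite normrM ler_pM.
Qed.

Lemma bm_scale c f : bounded_measurable f ->
  bounded_measurable (fun w => c * f w).
Proof. by move=> bf; apply: bm_mul => //; exact: bm_cst. Qed.

Lemma bm_norm f : bounded_measurable f -> bounded_measurable (fun w => `|f w|).
Proof.
move=> [mf [C fC]]; split; first exact: measurableT_comp.
by exists C => w; rewrite normr_id.
Qed.

Lemma bm_indic (A : set T) : measurable A -> bounded_measurable (\1_A : T -> R).
Proof.
move=> mA; split; first exact: measurable_indic.
by exists 1 => w; rewrite indicE; case: (_ \in _); rewrite /= ?normr1 ?normr0.
Qed.

Lemma bm_comp f (g : R -> R) : measurable_fun [set: T] f ->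
  measurable_fun [set: R] g -> (forall x, `|g x| <= 1) ->
  bounded_measurable (fun w => g (f w)).
Proof.
by move=> mf mg g1; split; [exact: (measurableT_comp mg mf)|exists 1 => w].
Qed.

Lemma bm_integrable f : bounded_measurable f ->
  P.-integrable setT (EFin \o f).
Proof.
move=> [mf [C fC]]; apply: measurable_bounded_integrable => //.
  by rewrite (le_lt_trans (probability_le1 _ _))// ltry.
exists C; split; first exact: num_real.
by move=> x Cx w _; rewrite /= (le_trans (fC w))// ltW.
Qed.

Lemma expectation_mean f : bounded_measurable f -> ('E_P[f] = (mean P f)%:E)%E.
Proof.
move=> bf; rewrite /mean /Rintegral unlock fineK//.
exact: integrable_fin_num (bm_integrable bf).
Qed.

Lemma mean_cst c : mean P (cst c) = c.
Proof. by rewrite -fine_expectation expectation_cst. Qed.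

Lemma mean_add f g : bounded_measurable f -> bounded_measurable g ->
  mean P (fun w => f w + g w) = mean P f + mean P g.
Proof. by move=> bf bg; apply: RintegralD => //; exact: bm_integrable. Qed.

Lemma mean_scale c f : bounded_measurable f ->
  mean P (fun w => c * f w) = c * mean P f.
Proof. by move=> bf; apply: RintegralZl => //; exact: bm_integrable. Qed.

Lemma mean_sub f g : bounded_measurable f -> bounded_measurable g ->
  mean P (fun w => f w - g w) = mean P f - mean P g.
Proof. by move=> bf bg; apply: RintegralB => //; exact: bm_integrable. Qed.

Lemma mean_le f g : bounded_measurable f -> bounded_measurable g ->
  (forall w, f w <= g w) -> mean P f <= mean P g.
Proof. by move=> bf bg fg; apply: le_Rintegral => //; exact: bm_integrable. Qed.

Lemma mean_norm f : bounded_measurable f ->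
  `|mean P f| <= mean P (fun w => `|f w|).
Proof. by move=> bf; apply: le_normr_Rintegral => //; exact: bm_integrable. Qed.

Lemma mean_indic (A : set T) : measurable A -> mean P \1_A = fine (P A).
Proof. by move=> mA; rewrite -fine_expectation expectation_indic. Qed.

Lemma measurable_cvg (f_ : nat -> T -> R) f :
  (forall n, measurable_fun [set: T] (f_ n)) ->
  (forall w, f_ n w @[n --> \oo] --> f w) -> measurable_fun [set: T] f.
Proof.
by move=> mf cf; apply: measurable_fun_cvg mf _ => w _; exact: cf.
Qed.

Lemma mean_cvg (f_ : nat -> T -> R) f C :
  (forall n, measurable_fun [set: T] (f_ n)) -> (forall n w, `|f_ n w| <= C) ->
  (forall w, f_ n w @[n --> \oo] --> f w) ->
  mean P (f_ n) @[n --> \oo] --> mean P f.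
Proof.
move=> mf fC cf; apply: fine_cvg.
have mlim := measurable_cvg mf cf.
have bf : bounded_measurable f.
  split=> //; exists C => w.
  have cn : `|f_ n w| @[n --> \oo] --> `|f w| by exact: cvg_norm (cf w).
  have nC : \forall n \near \oo, `|f_ n w| <= C by exact: nearW.
  by rewrite -(cvg_lim _ cn)//; apply: limr_le => //; apply/cvg_ex; eexists; exact: cn.
rewrite fineK; last exact: integrable_fin_num (bm_integrable bf).
have [] := @dominated_convergence _ T R P setT measurableT
  (fun n w => (f_ n w)%:E) (fun w => (f w)%:E) (cst C%:E) => //.
- by move=> n; apply/measurable_EFinP; exact: mf.
- by apply/measurable_EFinP.
- by apply/aeW => w _; apply: cvg_EFin; [exact: nearW|exact: cf].
- exact: (bm_integrable (bm_cst C)).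
- by apply/aeW => w n _; rewrite lee_fin.
Qed.

End mean.

(** * Laws of random vectors and trigonometric polynomials *)

Section trig_poly_limit.
Context {R : realType} (m : nat).

(** The diagonal choice: T_n is within 1/(n+1) of g_n on the cube of half-side
n+1, and every point is eventually in that cube. *)
Lemma trig_poly_limit (f : 'rV[R]_m -> R) (g_ : nat -> 'rV[R]_m -> R) (C : R) :
  (forall n, continuous (g_ n)) -> (forall n x, `|g_ n x| <= C) ->
  (forall x, g_ n x @[n --> \oo] --> f x) ->
  exists T_ : nat -> 'rV[R]_m -> R, [/\ forall n, trig_poly (T_ n),
    forall n x, `|T_ n x| <= C & forall x, T_ n x @[n --> \oo] --> f x].
Proof.
move=> cg gC gf.
have /choice[T_ T_P] n : exists T : 'rV[R]_m -> R, [/\ trig_poly T,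
    forall x, `|T x| <= C & forall x : 'rV[R]_m,
    (forall j, `|x ord0 j| <= n.+1%:R) -> `|T x - g_ n x| <= n.+1%:R^-1].
  by apply: trig_approx => //; rewrite ?invr_gt0 ltr0n.
exists T_; split=> [n|n x|x]; [by have [] := T_P n|by have [_ + _] := T_P n|].
suff : (T_ n x - g_ n x) @[n --> \oo] --> 0.
  move=> H; rewrite -[f x]add0r.
  rewrite (_ : (fun n => T_ n x) = (fun n => (T_ n x - g_ n x) + g_ n x)).
    exact: cvgD H (gf x).
  by apply/funext => n; rewrite subrK.
apply/cvgr0Pnorm_le => e e0.
pose K := \sum_j `|x ord0 j|.
near=> n; apply: (@le_trans _ _ (n.+1%:R^-1)).
  have [_ _ ->//] := T_P n; move=> j.
  apply: (@le_trans _ _ K).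
    by rewrite /K (bigD1 j)//= lerDl sumr_ge0.
  apply: (@le_trans _ _ n%:R); last by rewrite ler_nat.
  by near: n; exact: nbhs_infty_ger.
rewrite -[leRHS]invrK lef_pV2 ?posrE ?invr_gt0//.
apply: (@le_trans _ _ n%:R); last by rewrite ler_nat.
by near: n; exact: nbhs_infty_ger.
Unshelve. all: by end_near. Qed.

End trig_poly_limit.

Definition coord_measurable {R : realType} d (T : measurableType d) (m : nat)
    (X : T -> 'rV[R]_m) : Prop :=
  forall j, measurable_fun [set: T] (fun w => X w ord0 j).

Section trig_mean.
Context {R : realType} d (Omega : measurableType d) (P : probability Omega R).

Lemma measurable_dot m (X : Omega -> 'rV[R]_m) t : coord_measurable X ->
  measurable_fun [set: Omega] (fun w => dot t (X w)).
Proof.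
move=> mX; rewrite /dot; apply: measurable_sum => j.
by apply: measurable_funM => //; exact: measurable_cst.
Qed.

Lemma cos_norm_le1 (x : R) : `|cos x| <= 1.
Proof. by rewrite ler_norml cos_geN1 cos_le1. Qed.

Lemma sin_norm_le1 (x : R) : `|sin x| <= 1.
Proof. by rewrite ler_norml sin_geN1 sin_le1. Qed.

Lemma bm_cos (f : Omega -> R) : measurable_fun [set: Omega] f ->
  bounded_measurable (fun w => cos (f w)).
Proof.
move=> mf; apply: bm_comp => //; last exact: cos_norm_le1.
by apply: continuous_measurable_fun; exact: continuous_cos.
Qed.

Lemma bm_sin (f : Omega -> R) : measurable_fun [set: Omega] f ->
  bounded_measurable (fun w => sin (f w)).
Proof.
move=> mf; apply: bm_comp => //; last exact: sin_norm_le1.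
by apply: continuous_measurable_fun; exact: continuous_sin.
Qed.

Lemma bm_trig m (X : Omega -> 'rV[R]_m) T : coord_measurable X ->
  trig_poly T -> bounded_measurable (fun w => T (X w)).
Proof.
move=> mX; elim=> [t|t|S S' _ bS _ bS'|c S _ bS].
- by apply: bm_cos; exact: measurable_dot.
- by apply: bm_sin; exact: measurable_dot.
- exact: bm_add.
- exact: bm_scale.
Qed.

(** The coordinates of X being measurable, g(X) is measurable as a limit of
trigonometric polynomials of X. *)
Lemma measurable_continuous m (X : Omega -> 'rV[R]_m) (g : 'rV[R]_m -> R) C :
  coord_measurable X -> continuous g -> (forall x, `|g x| <= C) ->
  measurable_fun [set: Omega] (fun w => g (X w)).
Proof.
move=> mX cg gC.
have [T_ [tT _ Tg]] := @trig_poly_limit _ _ g (fun=> g) C (fun=> cg) (fun=> gC)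
  (fun x => cvg_cst (g x)).
apply: (@measurable_cvg _ _ _ (fun n w => T_ n (X w))) => // n.
by have [] := bm_trig mX (tT n).
Qed.

Definition uncorrelated (f g : Omega -> R) : Prop :=
  mean P (fun w => f w * g w) = mean P f * mean P g.

Section uncorrelated.
Variables (p q : nat) (X : Omega -> 'rV[R]_p) (Y : Omega -> 'rV[R]_q).
Hypotheses (mX : coord_measurable X) (mY : coord_measurable Y).
Hypothesis cc : forall t u,
  uncorrelated (fun w => cos (dot t (X w))) (fun w => cos (dot u (Y w))).
Hypothesis cs : forall t u,
  uncorrelated (fun w => cos (dot t (X w))) (fun w => sin (dot u (Y w))).
Hypothesis sc : forall t u,
  uncorrelated (fun w => sin (dot t (X w))) (fun w => cos (dot u (Y w))).
Hypothesis ss : forall t u,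
  uncorrelated (fun w => sin (dot t (X w))) (fun w => sin (dot u (Y w))).

(** Being uncorrelated is a bilinear condition, so it extends from sines and
cosines to their linear combinations. *)
Lemma uncorrelated_trig S T : trig_poly S -> trig_poly T ->
  uncorrelated (fun w => S (X w)) (fun w => T (Y w)).
Proof.
have addr f g h : bounded_measurable f -> bounded_measurable g ->
    bounded_measurable h -> uncorrelated f g -> uncorrelated f h ->
    uncorrelated f (fun w => g w + h w).
  move=> bf bg bh fg fh; rewrite /uncorrelated.
  under eq_fun do rewrite mulrDr.
  by rewrite !mean_add ?fg ?fh ?mulrDr//; exact: bm_mul.
have scaler f g c : bounded_measurable f -> bounded_measurable g ->
    uncorrelated f g -> uncorrelated f (fun w => c * g w).
  move=> bf bg fg; rewrite /uncorrelated.
  under eq_fun do rewrite mulrCA.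
  by rewrite !mean_scale ?fg 1?mulrCA//; exact: bm_mul.
have sym f g : uncorrelated f g -> uncorrelated g f.
  rewrite /uncorrelated => fg; under eq_fun do rewrite mulrC.
  by rewrite fg mulrC.
have bX := bm_trig mX; have bY := bm_trig mY.
move=> tS tT; elim: tS => [t|t|S1 S2 tS1 IH1 tS2 IH2|c S1 tS1 IH1].
- elim: tT => [u|u|T1 T2 tT1 IH1 tT2 IH2|c T1 tT1 IH1] //.
  + by apply: addr => //; [exact: bX (trig_cos _)|exact: bY|exact: bY].
  + by apply: scaler => //; [exact: bX (trig_cos _)|exact: bY].
- elim: tT => [u|u|T1 T2 tT1 IH1 tT2 IH2|c T1 tT1 IH1] //.
  + by apply: addr => //; [exact: bX (trig_sin _)|exact: bY|exact: bY].
  + by apply: scaler => //; [exact: bX (trig_sin _)|exact: bY].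
- by apply/sym/addr; [exact: bY|exact: bX|exact: bX|exact: sym|exact: sym].
- by apply/sym/scaler; [exact: bY|exact: bX|exact: sym].
Qed.

Lemma uncorrelated_limit (f : 'rV[R]_p -> R) (g : 'rV[R]_q -> R) f_ g_ C :
  (forall n, continuous (f_ n)) -> (forall n x, `|f_ n x| <= C) ->
  (forall x, f_ n x @[n --> \oo] --> f x) ->
  (forall n, continuous (g_ n)) -> (forall n x, `|g_ n x| <= C) ->
  (forall x, g_ n x @[n --> \oo] --> g x) ->
  uncorrelated (fun w => f (X w)) (fun w => g (Y w)).
Proof.
move=> cf fC ff cg gC gg.
have [S_ [tS SC Sf]] := trig_poly_limit cf fC ff.
have [T_ [tT TC Tg]] := trig_poly_limit cg gC gg.
have bS n := bm_trig mX (tS n); have bT n := bm_trig mY (tT n).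
have mS : mean P (fun w => S_ n (X w)) @[n --> \oo] -->
    mean P (fun w => f (X w)).
  apply: (@mean_cvg _ _ _ _ (fun n w => S_ n (X w)) _ C) => //.
  by move=> n; have [] := bS n.
have mT : mean P (fun w => T_ n (Y w)) @[n --> \oo] -->
    mean P (fun w => g (Y w)).
  apply: (@mean_cvg _ _ _ _ (fun n w => T_ n (Y w)) _ C) => //.
  by move=> n; have [] := bT n.
have mST : mean P (fun w => S_ n (X w) * T_ n (Y w)) @[n --> \oo] -->
    mean P (fun w => f (X w) * g (Y w)).
  apply: (@mean_cvg _ _ _ _ (fun n w => S_ n (X w) * T_ n (Y w)) _ (C * C)).
  - by move=> n; have [] := bm_mul (bS n) (bT n).
  - by move=> n w; rewrite normrM ler_pM.
  - by move=> w; apply: cvgM.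
rewrite /uncorrelated -(cvg_lim _ mST)//; apply: cvg_lim => //.
rewrite (_ : (fun n => _) = (fun n => mean P (fun w => S_ n (X w)) *
    mean P (fun w => T_ n (Y w)))); first exact: cvgM.
by apply/funext => n; exact: uncorrelated_trig.
Qed.

End uncorrelated.
End trig_mean.

Section levy_continuity.
Context {R : realType} (m : nat) (dn : nat -> measure_display)
  (Omegan : forall n, measurableType (dn n))
  (Pn : forall n, probability (Omegan n) R)
  (d : measure_display) (Omega : measurableType d) (P : probability Omega R)
  (Xn : forall n, Omegan n -> 'rV[R]_m) (X : Omega -> 'rV[R]_m).
Hypotheses (mXn : forall n, coord_measurable (@Xn n))
  (mX : coord_measurable X).

Definition outside {d'} {Omega' : measurableType d'} (Y : Omega' -> 'rV[R]_m)
  (K : R) : set Omega' := [set w | exists j, K < `|Y w ord0 j|].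

Lemma measurable_outside d' (Omega' : measurableType d')
    (Y : Omega' -> 'rV[R]_m) K : coord_measurable Y -> measurable (outside Y K).
Proof.
move=> mY; rewrite (_ : outside Y K =
    \big[setU/set0]_(j < m) ((fun w => `|Y w ord0 j|) @^-1` `]K, +oo[)).
  apply: bigsetU_measurable => j _; rewrite -[X in measurable X]setTI.
  have mj : measurable_fun [set: Omega'] (fun w => `|Y w ord0 j|).
    by apply: measurableT_comp => //; exact: mY.
  by apply: mj => //; exact: measurable_itv.
rewrite -bigcup_seq; apply/seteqP; split => [w [j Kj]|w [j _ /=]].
  by exists j; rewrite /= ?mem_index_enum// in_itv/= Kj.
by rewrite in_itv/= andbT => Kj; exists j.
Qed.

Lemma mean_sub_le d' (Omega' : measurableType d') (Q : probability Omega' R)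
    (Y : Omega' -> 'rV[R]_m) (g T : 'rV[R]_m -> R) (C K e : R) :
  coord_measurable Y -> continuous g -> (forall x, `|g x| <= C) ->
  trig_poly T -> (forall x, `|T x| <= C) ->
  (forall x : 'rV[R]_m, (forall j, `|x ord0 j| <= K) -> `|T x - g x| <= e) ->
  0 <= e ->
  `|mean Q (fun w => T (Y w)) - mean Q (fun w => g (Y w))| <=
    e + 2 * C * fine (Q (outside Y K)).
Proof.
move=> mY cg gC tT TC Tg e0.
have C0 : 0 <= C by apply: le_trans (gC 0).
have bT := bm_trig mY tT.
have bg : bounded_measurable (fun w => g (Y w)).
  by split; [exact: measurable_continuous gC|exists C].
have bD : bounded_measurable (fun w => T (Y w) - g (Y w)).
  have := bm_add bT (bm_scale (-1) bg).
  by under eq_fun do rewrite mulN1r.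
have mO := measurable_outside K mY.
rewrite -mean_sub//; apply: le_trans (mean_norm Q bD) _.
rewrite -mean_indic// -(mean_scale _ _ (bm_indic mO)).
rewrite -[X in X + _](mean_cst Q e) -mean_add; last 2 first.
- exact: bm_cst.
- exact/bm_scale/bm_indic.
apply: mean_le => [||w].
- exact: bm_norm.
- by apply: bm_add; [exact: bm_cst|exact/bm_scale/bm_indic].
have [Yw|Yw] := pselect (outside Y K w).
  rewrite indicE mem_set// mulr1 (le_trans (ler_normB _ _))//.
  by rewrite mulr_natl mulr2n -[leLHS]add0r !lerD.
rewrite indicE memNset// mulr0 addr0; apply: Tg => j.
by rewrite leNgt; apply/negP => Kj; apply: Yw; exists j.
Qed.

(** Replace g by a trigonometric polynomial T that is close to g on a large cube
and bounded by the same constant: the means of T converge, and the error is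
controlled by the probability of leaving the cube, uniformly in n. *)
Theorem levy_continuity :
  (forall t, mean (Pn n) (fun w => cos (dot t (Xn w))) @[n --> \oo] -->
    mean P (fun w => cos (dot t (X w)))) ->
  (forall t, mean (Pn n) (fun w => sin (dot t (Xn w))) @[n --> \oo] -->
    mean P (fun w => sin (dot t (X w)))) ->
  (forall e : R, 0 < e -> exists2 K : R, 0 < K &
    (forall n, fine (Pn n (outside (@Xn n) K)) <= e) /\
    fine (P (outside X K)) <= e) ->
  forall g : 'rV[R]_m -> R, continuous g ->
    (exists C : R, forall v, `|g v| <= C) ->
    mean (Pn n) (fun w => g (Xn w)) @[n --> \oo] --> mean P (fun w => g (X w)).
Proof.
move=> cosc sinc tight g cg [C gC].
have C0 : 0 <= C by apply: le_trans (gC 0).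
have trigc T : trig_poly T -> mean (Pn n) (fun w => T (Xn w)) @[n --> \oo] -->
    mean P (fun w => T (X w)).
  elim=> [//|//|S T' tS IHS tT IHT|c T' tT IHT].
  - rewrite (mean_add _ (bm_trig mX tS) (bm_trig mX tT)).
    rewrite (_ : (fun n => _) = (fun n => mean (Pn n) (fun w => S (Xn w)) +
      mean (Pn n) (fun w => T' (Xn w)))); first exact: cvgD.
    by apply/funext => n; apply: mean_add; exact: bm_trig.
  - rewrite (mean_scale _ _ (bm_trig mX tT)).
    rewrite (_ : (fun n => _) = (fun n => c * mean (Pn n) (fun w => T' (Xn w)))).
      exact: cvgM (cvg_cst c) IHT.
    by apply/funext => n; apply: mean_scale; exact: bm_trig.
apply/cvgrPdist_le => e e0.
(* two replacements costing 2 e1 each, and e1 for the convergence of T *)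
pose e1 := e / 6; have e10 : 0 < e1 by rewrite divr_gt0.
have e20 : 0 < e1 / (2 * (C + 1)) by rewrite divr_gt0// mulr_gt0// ltr_wpDl.
have [K K0 [tn t0]] := tight _ e20.
have [T [tT TC Tg]] := trig_approx cg gC K0 e10.
have Ce : 2 * C * (e1 / (2 * (C + 1))) <= e1.
  rewrite mulrCA -[leRHS]mulr1 ler_wpM2l ?(ltW e10)//.
  rewrite ler_pdivrMr ?mul1r ?mulr_gt0 ?ltr_wpDl//.
  by rewrite ler_wpM2l// lerDl.
near=> n.
have H0 := mean_sub_le P mX cg gC tT TC Tg (ltW e10).
have Hn := mean_sub_le (Pn n) (@mXn n) cg gC tT TC Tg (ltW e10).
have H1 : `|mean P (fun w => T (X w)) - mean (Pn n) (fun w => T (Xn w))| <= e1.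
  by near: n; have /cvgrPdist_le := trigc _ tT; exact.
have {}H0 : `|mean P (fun w => T (X w)) - mean P (fun w => g (X w))| <= 2 * e1.
  apply: le_trans H0 _; rewrite [leRHS]mulr_natl [leRHS]mulr2n lerD2l (le_trans _ Ce)//.
  by rewrite ler_wpM2l// mulr_ge0.
have {}Hn : `|mean (Pn n) (fun w => T (Xn w)) - mean (Pn n) (fun w => g (Xn w))|
    <= 2 * e1.
  apply: le_trans Hn _; rewrite [leRHS]mulr_natl [leRHS]mulr2n lerD2l (le_trans _ Ce)//.
  by rewrite ler_wpM2l// mulr_ge0.
move: H0 H1 Hn; rewrite /e1 !ler_norml => /andP[? ?] /andP[? ?] /andP[? ?].
by apply/andP; split; lra.
Unshelve. all: by end_near. Qed.

End levy_continuity.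

(** * Tails from the real part of the characteristic function *)

Section tail.
Context {R : realType}.

(** Halving a number that is at least 1 repeatedly, one meets [1, 2). *)
Lemma dyadic_scale (y : R) : 1 <= y -> exists k, 1 <= y / 2 ^+ k < 2.
Proof.
move=> y1; have ex : exists n, y < 2 ^+ n.
  by exists (Num.bound y); exact: upper_nthrootP.
have [n yn nmin] := ex_minnP ex.
case: n yn nmin => [|k yk kmin]; first by rewrite expr0 ltNge y1.
exists k; have k0 : (0 : R) < 2 ^+ k by exact: exprn_gt0.
rewrite ler_pdivlMr// ltr_pdivrMr// mul1r -exprS yk andbT leNgt.
by apply/negP => /kmin; rewrite ltnn.
Qed.

Lemma cos_normr (z : R) : cos `|z| = cos z.
Proof. by case: (ger0P z) => // _; rewrite cosN. Qed.

Lemma cos_le_cos1 (z : R) : 1 <= `|z| < 2 -> cos z <= cos 1.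
Proof.
move=> /andP[z1 z2]; rewrite -cos_normr leNgt ltr_cos ?in_itv/= -?leNgt//.
- by apply/andP; split => //; rewrite (le_trans (ltW z2))// pi_ge2.
- by apply/andP; split => //; rewrite (le_trans _ (@pi_ge2 R))// ler1n.
Qed.

Lemma cos1_lt1 : cos 1 < 1 :> R.
Proof.
rewrite -[ltRHS]cos0 ltr_cos ?in_itv/= ?lexx ?pi_ge0// ler01/=.
by rewrite (le_trans _ (@pi_ge2 R))// ler1n.
Qed.

Context d (T : measurableType d) (P : probability T R).

(** If |Z| >= 1/u then some u 2^-k Z has absolute value in [1, 2), where 1 - cos
is at least 1 - cos 1.  Markov's inequality bounds the probability of this for
each k, and the hypothesis makes the bounds summable. *)
Lemma tail_le (Z : T -> R) (u c rho : R) : measurable_fun [set: T] Z ->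
  0 < u -> 0 <= c -> 0 <= rho < 1 ->
  (forall k, 1 - mean P (fun w => cos (u / 2 ^+ k * Z w)) <= c * rho ^+ k) ->
  (P [set w | (u^-1 <= `|Z w|)%R] <= (c / (1 - cos 1) / (1 - rho))%:E)%E.
Proof.
move=> mZ u0 c0 /andP[r0 r1] H.
have kappa0 : 0 < 1 - cos (1 : R) by rewrite subr_gt0 cos1_lt1.
have rho0 : 0 < 1 - rho by rewrite subr_gt0.
pose f k w := 1 - cos (u / 2 ^+ k * Z w).
have bc k : bounded_measurable (fun w => cos (u / 2 ^+ k * Z w)).
  by apply: bm_cos; apply: measurable_funM => //; exact: measurable_cst.
have bf k : bounded_measurable (f k).
  have := bm_add (bm_cst _ (1 : R)) (bm_scale (-1) (bc k)).
  by rewrite /f; under [X in bounded_measurable X -> _]eq_fun do rewrite mulN1r.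
pose B k := [set w | 1 - cos 1 <= f k w].
have mB k : measurable (B k).
  rewrite /B -[X in measurable X]setTI; apply: (measurable_fun_le (f := cst _)) => //.
  by have [] := bf k.
have PB k : (P (B k) <= (c / (1 - cos 1) * rho ^+ k)%:E)%E.
  rewrite -(fineK (fin_num_measure P _ (mB k))) lee_fin mulrAC ler_pdivlMr// mulrC.
  rewrite -mean_indic// -mean_scale; last exact: bm_indic.
  apply: le_trans (H k); rewrite -[X in _ <= X - mean _ _](mean_cst P 1) -mean_sub//;
    last exact: bm_cst.
  apply: mean_le => [||w]; [exact/bm_scale/bm_indic|exact: bf k|].
  rewrite indicE; have [Bw|Bw] := boolP (w \in B k).
    by rewrite mulr1; move: Bw; rewrite inE.
  by rewrite mulr0 subr_ge0 cos_le1.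
have mA : measurable [set w | u^-1 <= `|Z w|].
  rewrite -[X in measurable X]setTI; apply: (measurable_fun_le (f := cst _)) => //.
  exact: measurableT_comp.
apply: le_trans (measure_sigma_subadditive P mB mA _) _.
  move=> w /= uZ; have y1 : 1 <= u * `|Z w| by rewrite mulrC -ler_pdivrMr// div1r.
  have [k /andP[k1 k2]] := dyadic_scale y1.
  exists k => //; rewrite /B /= /f lerD2l lerN2 cos_le_cos1//.
  rewrite !normrM (gtr0_norm u0) ger0_norm ?invr_ge0 ?exprn_ge0//.
  by rewrite mulrAC k1.
apply: lime_le; first by apply: is_cvg_nneseries => k _ _; exact: measure_ge0.
apply: nearW => n; apply: (@le_trans _ _
    (\sum_(0 <= k < n) (c / (1 - cos 1) * rho ^+ k)%:E)%E).
  by apply: lee_sum => k _; exact: PB.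
rewrite sumEFin lee_fin -mulr_sumr ler_wpM2l ?divr_ge0// ?(ltW kappa0)//.
rewrite -[leRHS]mul1r ler_pdivlMr// big_mkord mulrC -opprB mulNr -subrX1 opprB.
by rewrite gerBl exprn_ge0.
Qed.

End tail.

(** * Independence of generated sigma-algebras *)

Section independence.
Context {R : realType} d (Omega : measurableType d) (P : probability Omega R).

Definition indep_events (A B : set Omega) : Prop :=
  P (A `&` B) = (P A * P B)%E.

Lemma indep_eventsC A B : indep_events A B -> indep_events B A.
Proof. by rewrite /indep_events setIC muleC. Qed.

(** The events independent of B form a Dynkin system. *)
Lemma indep_g_sigma (G : set (set Omega)) (B : set Omega) :
  setI_closed G -> G `<=` measurable -> measurable B ->
  (forall A, G A -> indep_events A B) ->
  forall A, <<s G >> A -> measurable A /\ indep_events A B.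
Proof.
move=> GI Gm mB GB A; rewrite -setI_closed_g_dynkin_g_sigma_algebra//.
move: A; apply: smallest_sub; last by move=> A GA; split; [exact: Gm|exact: GB].
split=> [|A [mA iA]|F tF HF].
- by split=> //; rewrite /indep_events setTI probability_setT mul1e.
- split; first exact: measurableC.
  rewrite /indep_events setIC -setDE measureD//; last first.
    by rewrite (le_lt_trans (probability_le1 _ _))// ltry.
  transitivity (P B - P A * P B)%E.
    by congr (_ - _)%E; rewrite setIC; exact: iA.
  rewrite probability_setC//.
  have PA := fin_num_measure P _ mA; have PB := fin_num_measure P _ mB.
  by rewrite muleBl ?mul1e// fin_num_adde_defr.
- split; first by apply: bigcup_measurable => k _; have [] := HF k.
  have mF k : measurable (F k) by have [] := HF k.
  rewrite /indep_events setI_bigcupl measure_semi_bigcup; last 3 first.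
  + by move=> k; apply: measurableI.
  + by under eq_fun do rewrite setIC; exact: trivIset_setIl.
  + by apply: bigcup_measurable => k _; exact: measurableI.
  rewrite measure_semi_bigcup//; last exact: bigcup_measurable.
  rewrite muleC -(fineK (fin_num_measure P _ mB)) -nneseriesZl//.
  apply: eq_eseriesr => k _; rewrite fineK ?fin_num_measure// muleC.
  by have [] := HF k.
Qed.

(** A pi-system that generates the sigma-algebra of the family X. *)
Definition boxes (J : Type) (D : set J) (X : J -> {RV P >-> R}) :
    set (set Omega) :=
  [set A | exists k (f : 'I_k -> J) (t : 'I_k -> R), (forall i, D (f i)) /\
    A = [set w | forall i, t i < X (f i) w]].

Lemma boxes_setI J D (X : J -> {RV P >-> R}) : setI_closed (boxes D X).
Proof.
move=> _ _ [k [f [t [Df ->]]]] [l [g [u [Dg ->]]]].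
exists (k + l)%N, (fun i : 'I_(k + l) =>
    match fintype.split i with inl i => f i | inr j => g j end),
  (fun i : 'I_(k + l) =>
    match fintype.split i with inl i => t i | inr j => u j end).
split=> [i|]; first by case: fintype.split.
apply/seteqP; split=> [w [tf ug] i|w tu] /=; first by case: fintype.split.
split=> i.
  by have := tu (lshift l i); rewrite (unsplitK (inl i : 'I_k + 'I_l)).
by have := tu (rshift k i); rewrite (unsplitK (inr i : 'I_k + 'I_l)).
Qed.

Lemma boxes_measurable J D (X : J -> {RV P >-> R}) : boxes D X `<=` measurable.
Proof.
move=> _ [k [f [t [Df ->]]]].
rewrite (_ : [set _ | _] = \bigcap_(i in [set: 'I_k]) (X (f i) @^-1` `]t i, +oo[)).
  apply: fin_bigcap_measurable => // i _.
  by rewrite -[X in measurable X]setTI; exact: measurable_funP.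
apply/seteqP; split => w H i /=; first by rewrite in_itv/= H.
by have := H i I; rewrite /= in_itv/= andbT.
Qed.

Lemma generated_sub_boxes J D (X : J -> {RV P >-> R}) :
  generated_sigma D X `<=` <<s boxes D X >>.
Proof.
apply: smallest_sub; first exact: smallest_sigma_algebra.
move=> _ [j Dj [B mB <-]].
have sub : @measurable _ R `<=` image_set_system setT (X j) <<s boxes D X >>.
  rewrite [X in X `<=` _](_ : _ = <<s @RGenOInfty.G R >>); last exact: (@RGenOInfty.measurableE R).
  apply: smallest_sub.
    by apply: sigma_algebra_image; exact: smallest_sigma_algebra.
  move=> _ [x ->]; apply: sub_sigma_algebra; rewrite setTI.
  exists 1%N, (fun=> j), (fun=> x); split => //.
  apply/seteqP; split => w /=; first by rewrite in_itv/= andbT.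
  by move=> /(_ ord0); rewrite in_itv/= andbT.
by have := sub _ mB; rewrite /image_set_system /= setTI.
Qed.

Lemma generated_measurable J D (X : J -> {RV P >-> R}) :
  generated_sigma D X `<=` measurable.
Proof.
apply: smallest_sub; first exact: sigma_algebra_measurable.
by move=> _ [j Dj [B mB <-]]; rewrite -[X in measurable X]setTI; exact: measurable_funP.
Qed.

Lemma indep_generated_boxes J D (X : J -> {RV P >-> R})
    J' D' (X' : J' -> {RV P >-> R}) :
  (forall A B, boxes D X A -> boxes D' X' B -> indep_events A B) ->
  forall A B, generated_sigma D X A -> generated_sigma D' X' B ->
    indep_events A B.
Proof.
move=> H A B gA gB.
have mA := generated_measurable gA.
have hB C : boxes D X C -> indep_events C B.
  move=> bC; apply: indep_eventsC.
  apply: (indep_g_sigma (@boxes_setI _ D' X') (@boxes_measurable _ D' X') _ _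
    (generated_sub_boxes gB)).2; first exact: boxes_measurable bC.
  by move=> E bE; apply/indep_eventsC/H.
exact: (indep_g_sigma (@boxes_setI _ D X) (@boxes_measurable _ D X)
  (generated_measurable gB) hB (generated_sub_boxes gA)).2.
Qed.

Definition ramp (y : R) : R := Num.max 0 (Num.min 1 y).

Lemma ramp_continuous : continuous ramp.
Proof.
move=> y; apply: (@continuous_max _ _ (cst (0 : R)) (Num.min (1 : R))).
  exact: cvg_cst.
by apply: (@continuous_min _ _ (cst (1 : R)) id); [exact: cvg_cst|exact: cvg_id].
Qed.

Lemma ramp01 y : 0 <= ramp y <= 1.
Proof. by rewrite /ramp le_max lexx/= ge_max ler01/= ge_min lexx. Qed.

Lemma ramp_cvg (x t : R) : ramp (n%:R * (x - t)) @[n --> \oo] --> ((t < x)%R%:R : R).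
Proof.
have [tx|xt] := ltP t x.
  apply: cvg_near_cst; near=> n.
  rewrite /ramp min_l ?max_r//.
  rewrite -ler_pdivrMr ?subr_gt0//; near: n; exact: nbhs_infty_ger.
apply: cvg_near_cst; apply: nearW => n; rewrite /ramp.
have n0 : n%:R * (x - t) <= 0 by rewrite mulr_ge0_le0// subr_le0.
by rewrite min_r ?max_l// (le_trans n0).
Unshelve. all: by end_near. Qed.

(** Continuous functions with values in [0, 1] that increase to the indicator of
the orthant x_i > t_i. *)
Definition box_ramp m (t : 'I_m -> R) (n : nat) (x : 'rV[R]_m) : R :=
  \prod_i ramp (n%:R * (x ord0 i - t i)).

Lemma box_ramp_continuous m (t : 'I_m -> R) n : continuous (box_ramp t n).
Proof.
apply: (@continuous_big R 'I_m *%R 1 xpredT (@mul_continuous R)) => i _ x.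
apply: (@continuous_comp _ _ _
  (fun x : 'rV[R]_m => n%:R * (x ord0 i - t i)) ramp); last exact: ramp_continuous.
apply: (@continuousM _ _ (cst n%:R) (fun x : 'rV[R]_m => x ord0 i - t i)).
  exact: cst_continuous.
apply: (@continuousB _ _ _ (fun x : 'rV[R]_m => x ord0 i) (cst (t i))).
  exact: coord_continuous.
exact: cst_continuous.
Qed.

Lemma box_ramp_norm m (t : 'I_m -> R) n x : `|box_ramp t n x| <= 1.
Proof.
rewrite normr_prod; apply: prodr_ile1 => i _.
by have /andP[r0 r1] := ramp01 (n%:R * (x ord0 i - t i)); rewrite ger0_norm// r0.
Qed.

Lemma box_ramp_cvg m (t : 'I_m -> R) (x : 'rV[R]_m) :
  box_ramp t n x @[n --> \oo] -->
    (\1_[set x : 'rV[R]_m | forall i, t i < x ord0 i] x : R).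
Proof.
rewrite indicE (_ : _%:R = \prod_i (t i < x ord0 i)%R%:R :> R).
  apply: (@cvg_big R 'I_m *%R 1 xpredT (@mul_continuous R)) => i _.
  exact: ramp_cvg.
have [xt|] := pselect (forall i, t i < x ord0 i).
  by rewrite mem_set// big1// => i _; rewrite xt.
move=> /[dup] nxt /existsNP[i /negP/negbTE xi].
by rewrite memNset// (bigD1 i)//= xi mul0r.
Qed.

Definition trig_uncorrelated (a b : Omega -> R) : Prop :=
  [/\ uncorrelated P (fun w => cos (a w)) (fun w => cos (b w)),
      uncorrelated P (fun w => cos (a w)) (fun w => sin (b w)),
      uncorrelated P (fun w => sin (a w)) (fun w => cos (b w)) &
      uncorrelated P (fun w => sin (a w)) (fun w => sin (b w))].

(** Product-to-sum formulas: the mean of each product of a sine or cosine of a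
with one of b is expressed by the characteristic functions of a + b and a - b.
The vanishing of the means of the sines expresses symmetry of the laws. *)
Lemma trig_uncorrelatedP (a b : Omega -> R) :
  measurable_fun [set: Omega] a -> measurable_fun [set: Omega] b ->
  mean P (fun w => sin (a w)) = 0 -> mean P (fun w => sin (b w)) = 0 ->
  (forall c, c = 1 \/ c = -1 ->
    mean P (fun w => sin (a w + c * b w)) = 0 /\
    mean P (fun w => cos (a w + c * b w)) =
      mean P (fun w => cos (a w)) * mean P (fun w => cos (b w))) ->
  trig_uncorrelated a b.
Proof.
move=> ma mb sa sb H.
have [s1 c1] := H 1 (or_introl erefl).
have [s2 c2] := H (-1) (or_intror erefl).
have mc c : measurable_fun [set: Omega] (fun w => a w + c * b w).
  by apply: measurable_funD => //; apply: measurable_funM => //; exact: measurable_cst.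
have bs c := bm_sin (mc c); have bc c := bm_cos (mc c).
split; rewrite /uncorrelated ?sa ?sb ?mulr0 ?mul0r.
- have -> : (fun w => cos (a w) * cos (b w)) =
    (fun w => 1 / 2 * (cos (a w + 1 * b w) + cos (a w + (-1) * b w))).
    by apply/funext => w; rewrite (mul1r (b w)) (mulN1r (b w)) cosD cosB; field.
  by rewrite mean_scale ?mean_add ?c1 ?c2//; [field|exact: bm_add].
- have -> : (fun w => cos (a w) * sin (b w)) =
    (fun w => 1 / 2 * (sin (a w + 1 * b w) + (-1) * sin (a w + (-1) * b w))).
    by apply/funext => w; rewrite (mul1r (b w)) (mulN1r (b w)) sinD sinB; field.
  rewrite mean_scale ?mean_add ?mean_scale ?s1 ?s2//; first by field.
  + exact: bm_scale.
  + by apply: bm_add => //; exact: bm_scale.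
- have -> : (fun w => sin (a w) * cos (b w)) =
    (fun w => 1 / 2 * (sin (a w + 1 * b w) + sin (a w + (-1) * b w))).
    by apply/funext => w; rewrite (mul1r (b w)) (mulN1r (b w)) sinD sinB; field.
  by rewrite mean_scale ?mean_add ?s1 ?s2//; [field|exact: bm_add].
- have -> : (fun w => sin (a w) * sin (b w)) =
    (fun w => 1 / 2 * (cos (a w + (-1) * b w) + (-1) * cos (a w + 1 * b w))).
    by apply/funext => w; rewrite (mul1r (b w)) (mulN1r (b w)) cosB cosD; field.
  rewrite mean_scale ?mean_add ?mean_scale ?c1 ?c2//; first by field.
  + exact: bm_scale.
  + by apply: bm_add => //; exact: bm_scale.
Qed.

(** A factorization of characteristic functions yields independence of the
generated sigma-algebras: indicators of boxes are bounded limits of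
trigonometric polynomials, and boxes form a pi-system. *)
Lemma indep_generated J D (X : J -> {RV P >-> R})
    J' D' (X' : J' -> {RV P >-> R}) :
  (forall p (f : 'I_p -> J) q (g : 'I_q -> J') (t : 'I_p -> R) (u : 'I_q -> R),
    (forall i, D (f i)) -> (forall k, D' (g k)) ->
    trig_uncorrelated (fun w => \sum_i t i * X (f i) w)
      (fun w => \sum_k u k * X' (g k) w)) ->
  forall A B, generated_sigma D X A -> generated_sigma D' X' B ->
    indep_events A B.
Proof.
move=> H; apply: indep_generated_boxes => A B bA bB.
have mA := boxes_measurable bA; have mB := boxes_measurable bB.
move: bA bB mA mB => [p [f [t [Df AE]]]] [q [g [u [Dg BE]]]] mA mB.
pose Xr w : 'rV[R]_p := \row_i X (f i) w.
pose Yr w : 'rV[R]_q := \row_k X' (g k) w.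
have mX : coord_measurable Xr.
  by move=> i; rewrite (_ : (fun w => _) = X (f i))//; apply/funext => w; rewrite mxE.
have mY : coord_measurable Yr.
  by move=> i; rewrite (_ : (fun w => _) = X' (g i))//; apply/funext => w; rewrite mxE.
have tu s v : trig_uncorrelated (fun w => dot s (Xr w)) (fun w => dot v (Yr w)).
  have := H p f q g (fun i => s ord0 i) (fun i => v ord0 i) Df Dg.
  congr trig_uncorrelated; apply/funext => w; apply: eq_bigr => i _; by rewrite mxE.
have : uncorrelated P
    (fun w => \1_[set x : 'rV[R]_p | forall i, t i < x ord0 i] (Xr w))
    (fun w => \1_[set x : 'rV[R]_q | forall i, u i < x ord0 i] (Yr w)).
  apply: (@uncorrelated_limit _ _ _ P _ _ Xr Yr mX mY _ _ _ _ _ _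
      (box_ramp t) (box_ramp u) 1).
  - by move=> s v; have [] := tu s v.
  - by move=> s v; have [] := tu s v.
  - by move=> s v; have [] := tu s v.
  - by move=> s v; have [] := tu s v.
  - exact: box_ramp_continuous.
  - exact: box_ramp_norm.
  - exact: box_ramp_cvg.
  - exact: box_ramp_continuous.
  - exact: box_ramp_norm.
  - exact: box_ramp_cvg.
have -> : (fun w => \1_[set x : 'rV[R]_p | forall i, t i < x ord0 i] (Xr w)) =
    \1_A :> (_ -> R).
  apply/funext => w; rewrite !indicE AE; congr (nat_of_bool _)%:R.
  by apply/idP/idP; rewrite !inE => + i => /(_ i); rewrite mxE.
have -> : (fun w => \1_[set x : 'rV[R]_q | forall i, u i < x ord0 i] (Yr w)) =
    \1_B :> (_ -> R).
  apply/funext => w; rewrite !indicE BE; congr (nat_of_bool _)%:R.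
  by apply/idP/idP; rewrite !inE => + i => /(_ i); rewrite mxE.
rewrite /uncorrelated (_ : (fun w => _) = \1_(A `&` B)); last first.
  by apply/funext => w; rewrite indicI.
rewrite !mean_indic//; last exact: measurableI.
rewrite /indep_events => PAB.
rewrite -[LHS]fineK ?fin_num_measure//; last exact: measurableI.
by rewrite PAB EFinM !fineK ?fin_num_measure.
Qed.

End independence.

(** * Power integrals of step functions *)

Definition step {R : realType} (k : nat) (theta : 'I_k -> R)
  (A : 'I_k -> set R) (x : R) : R := \sum_(j < k) theta j * \1_(A j) x.

Definition power_integral {R : realType} (alpha f : R -> R) : R :=
  \int[leb R]_x (`|f x| `^ alpha x).

Section finite_lebesgue.
Context {R : realType}.
Implicit Types A B : set R.

Lemma finite_lebesgue_sub A B : measurable (A : set (lebesgueType R)) ->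
  A `<=` B -> finite_lebesgue B -> finite_lebesgue A.
Proof.
move=> mA AB [mB Boo]; split=> //; apply: le_lt_trans Boo.
by apply: le_measure; rewrite ?inE.
Qed.

Lemma finite_lebesgueI A B : finite_lebesgue A ->
  measurable (B : set (lebesgueType R)) -> finite_lebesgue (A `&` B).
Proof.
move=> fA mB; apply: finite_lebesgue_sub (fA); last exact: subIsetl.
by apply: measurableI => //; case: fA.
Qed.

Lemma finite_lebesgueD A B : finite_lebesgue A ->
  measurable (B : set (lebesgueType R)) -> finite_lebesgue (A `\` B).
Proof. by move=> fA mB; apply: finite_lebesgueI => //; exact: measurableC. Qed.

Lemma finite_lebesgue0 : finite_lebesgue (set0 : set R).
Proof. by split; rewrite ?measure0. Qed.

End finite_lebesgue.

Section power_integral.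
Context {R : realType} (a b : R).
Hypothesis a0 : 0 < a.
Implicit Types alpha f g : R -> R.

Lemma powR_posE (x y : R) : 0 < y -> x `^ y = (x != 0)%:R * expR (y * ln x).
Proof.
move=> y0; rewrite /powR; case: eqVneq => [->|_]; last by rewrite mul1r.
by rewrite (gt_eqF y0) mul0r.
Qed.

Definition exponent alpha : Prop :=
  measurable_fun [set: lebesgueType R] (alpha : lebesgueType R -> R) /\
  forall x, a <= alpha x <= b.

Lemma exponent_gt0 alpha x : exponent alpha -> 0 < alpha x.
Proof. by move=> [_ /(_ x)/andP[ax _]]; exact: lt_le_trans ax. Qed.

Lemma measurable_power alpha f : exponent alpha ->
  measurable_fun [set: lebesgueType R] (f : lebesgueType R -> R) ->
  measurable_fun [set: lebesgueType R]
    ((fun x => `|f x| `^ alpha x) : lebesgueType R -> R).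
Proof.
move=> ea mf.
rewrite (_ : (fun x => _) = (fun x : lebesgueType R =>
    \1_[set x | f x != 0] x * expR (alpha x * ln `|f x|))); last first.
  apply/funext => x; rewrite powR_posE ?(exponent_gt0 _ ea)// normr_eq0 indicE.
  congr ((_ : bool)%:R * _); apply/idP/idP; first by rewrite inE.
  by rewrite inE.
apply: measurable_funM.
  apply: measurable_indic.
  rewrite (_ : [set x | _] = f @^-1` [set~ 0]).
    rewrite -[X in measurable X]setTI; apply: mf => //.
    by apply: measurableC; exact: measurable_set1.
  by apply/seteqP; split => x /=; [move=> /eqP|move=> /eqP].
apply: (measurableT_comp (@measurable_expR R)).
apply: measurable_funM; first by case: ea.
apply: (measurableT_comp (@measurable_ln R)).
exact: (measurableT_comp (@normr_measurable R setT)).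
Qed.

Lemma powR_le_add (u y : R) : 0 <= u -> a <= y <= b -> u `^ y <= u `^ a + u `^ b.
Proof.
move=> u0 /andP[ay yb]; have [u1|/ltW u1] := leP 1 u.
  by rewrite -[leLHS]add0r lerD ?powR_ge0// ler_powR.
have [->|un0] := eqVneq u 0.
  by rewrite powR0 ?addr_ge0 ?powR_ge0// gt_eqF// (lt_le_trans a0).
rewrite -[leLHS]addr0 lerD ?powR_ge0//.
by apply: ger_powR => //; rewrite u1 lt0r un0 u0.
Qed.

(** A bound that does not depend on the exponent, hence a domination for all the
exponents with values in [a, b] at once. *)
Lemma power_step_bound k (theta : 'I_k -> R) A alpha x : exponent alpha ->
  `|step theta A x| `^ alpha x <=
  ((\sum_j `|theta j|) `^ a + (\sum_j `|theta j|) `^ b) * \sum_j \1_(A j) x.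
Proof.
move=> ea; have [_ /(_ x) axb] := ea.
have C0 : 0 <= \sum_j `|theta j| by exact: sumr_ge0.
have S0 : 0 <= \sum_j \1_(A j) x :> R by exact: sumr_ge0.
have [s0|sn0] := eqVneq (step theta A x) 0.
  rewrite s0 normr0 powR0 ?gt_eqF ?(exponent_gt0 _ ea)//.
  by rewrite mulr_ge0// addr_ge0// powR_ge0.
have S1 : 1 <= \sum_j \1_(A j) x :> R.
  have [j xj] : exists j, A j x.
    apply: contrapT => /forallNP H; move/eqP: sn0; apply.
    by rewrite /step big1// => j _; rewrite indicE memNset// mulr0.
  by rewrite (bigD1 j)//= indicE mem_set// lerDl sumr_ge0.
apply: le_trans (ler_peMr _ S1); last by rewrite addr_ge0// powR_ge0.
apply: (@le_trans _ _ ((\sum_j `|theta j|) `^ alpha x)); last exact: powR_le_add.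
apply: ge0_ler_powR; rewrite ?nnegrE ?(ltW (exponent_gt0 _ ea))//.
apply: le_trans (ler_norm_sum _ _ _) _; apply: ler_sum => j _.
by rewrite normrM indicE ler_piMr// ger0_norm// lern1 leq_b1.
Qed.

Lemma measurable_step k (theta : 'I_k -> R) (A : 'I_k -> set R) :
  (forall j, finite_lebesgue (A j)) ->
  measurable_fun [set: lebesgueType R] (step theta A : lebesgueType R -> R).
Proof.
move=> fA; apply: measurable_sum => j; apply: measurable_funM.
  exact: measurable_cst.
by apply: measurable_indic; case: (fA j).
Qed.

Lemma integrable_finite_indic A : finite_lebesgue A ->
  (leb R).-integrable [set: lebesgueType R] (fun x => (\1_A x)%:E).
Proof.
move=> [mA Aoo]; apply/integrableP; split.
  by apply/measurable_EFinP; exact: measurable_indic.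
rewrite (eq_integral (fun x : lebesgueType R => (\1_A x)%:E)); last first.
  by move=> x _; rewrite gee0_abs ?lee_fin.
by rewrite integral_indic// setIT.
Qed.

Lemma integrable_sum_indic k (A : 'I_k -> set R) c :
  (forall j, finite_lebesgue (A j)) ->
  (leb R).-integrable [set: lebesgueType R]
    (fun x => (c * \sum_j \1_(A j) x)%:E).
Proof.
move=> fA; under eq_fun do rewrite EFinM.
apply: integrableZl => //; under eq_fun do rewrite -sumEFin.
by apply: integrable_sum => // j _; exact: integrable_finite_indic.
Qed.

Lemma integrable_power_step alpha k (theta : 'I_k -> R) (A : 'I_k -> set R) :
  exponent alpha -> (forall j, finite_lebesgue (A j)) ->
  (leb R).-integrable [set: lebesgueType R]
    (fun x => (`|step theta A x| `^ alpha x)%:E).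
Proof.
move=> ea fA.
pose c := (\sum_j `|theta j|) `^ a + (\sum_j `|theta j|) `^ b.
apply: (@le_integrable _ _ _ (leb R) setT measurableT _
    (fun x => (c * \sum_j \1_(A j) x)%:E)).
- apply/(@measurable_EFinP _ (lebesgueType R)).
  exact: measurable_power ea (measurable_step theta fA).
- move=> x _; rewrite lee_fin ger0_norm ?powR_ge0// ger0_norm.
    exact: power_step_bound.
  by rewrite mulr_ge0 ?addr_ge0 ?powR_ge0// sumr_ge0.
- exact: integrable_sum_indic.
Qed.

Lemma multistable_space_indic alpha A : exponent alpha ->
  finite_lebesgue A -> multistable_space alpha (\1_A).
Proof.
move=> ea [mA Aoo]; split; first exact: measurable_indic.
rewrite (_ : (fun x => _) = (fun x => (\1_A x)%:E)); last first.
  apply/funext => x; rewrite indicE; case: (_ \in _) => /=.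
    by rewrite normr1 powR1.
  by rewrite normr0 powR0// gt_eqF// (exponent_gt0 _ ea).
by rewrite integral_indic// setIT.
Qed.

(** At each point one of the two functions vanishes, and 0 to a positive power
is 0. *)
Lemma power_integral_disjoint alpha f g : exponent alpha ->
  (leb R).-integrable [set: lebesgueType R] (fun x => (`|f x| `^ alpha x)%:E) ->
  (leb R).-integrable [set: lebesgueType R] (fun x => (`|g x| `^ alpha x)%:E) ->
  (forall x, f x * g x = 0) ->
  power_integral alpha (fun x => f x + g x) =
  power_integral alpha f + power_integral alpha g.
Proof.
move=> ea If Ig fg0; rewrite /power_integral -RintegralD//.
congr Rintegral; apply/funext => x.
have al0 : alpha x != 0 by rewrite gt_eqF// exponent_gt0.
have /eqP := fg0 x; rewrite mulf_eq0 => /orP[]/eqP->.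
  by rewrite normr0 powR0// !add0r.
by rewrite normr0 powR0// !addr0.
Qed.

Lemma power_integral_le alpha k (theta : 'I_k -> R) (A : 'I_k -> set R) D c :
  exponent alpha -> (forall j, finite_lebesgue (A j)) -> finite_lebesgue D ->
  (forall x, `|step theta A x| `^ alpha x <= c * \1_D x) ->
  power_integral alpha (step theta A) <= c * fine (leb R D).
Proof.
move=> ea fA fD H; have [mD _] := fD.
have ID : (leb R).-integrable [set: lebesgueType R] (fun x => (\1_D x)%:E).
  exact: integrable_finite_indic.
have -> : fine (leb R D) = \int[leb R]_x \1_D x.
  by rewrite /Rintegral integral_indic// setIT.
rewrite -RintegralZl//; apply: le_Rintegral => //.
- exact: integrable_power_step.
- exact: (integrableZl measurableT c ID).
Qed.

End power_integral.

(** * Multistable measures on disjoint sets *)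

Section multistable.
Context {R : realType} (a b : R) (alpha : R -> R)
  d (Omega : measurableType d) (P : probability Omega R)
  (I : (R -> R) -> {RV P >-> R}).
Hypotheses (a0 : 0 < a) (ea : exponent a b alpha)
  (hI : is_multistable_integral alpha I).

Local Notation M := (multistable_measure I).

Definition combination k (theta : 'I_k -> R) (A : 'I_k -> set R) (w : Omega) : R :=
  \sum_(j < k) theta j * M (A j) w.

Lemma measurable_combination k theta (A : 'I_k -> set R) :
  measurable_fun [set: Omega] (combination theta A).
Proof.
apply: measurable_sum => j; apply: measurable_funM; first exact: measurable_cst.
exact: measurable_funP.
Qed.

Lemma multistable_charfun k (theta : 'I_k -> R) (A : 'I_k -> set R) :
  (forall j, finite_lebesgue (A j)) ->
  mean P (fun w => cos (combination theta A w)) =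
    expR (- power_integral alpha (step theta A)) /\
  mean P (fun w => sin (combination theta A w)) = 0.
Proof.
move=> fA.
have := hI theta (fun j => multistable_space_indic a0 ea (fA j)).
by rewrite /cexpectation !fine_expectation => -[-> ->].
Qed.

(** The sum over k of the bounds for 1 - phi(u 2^-k) when the step function is
an indicator of a set of measure 1, times the factor 1 / (1 - cos 1) that comes
from Markov's inequality; the ratio of the series is 2^-a. *)
Definition tail_constant (u : R) : R :=
  (u `^ a + u `^ b) / (1 - cos 1) / (1 - 2^-1 `^ a).

Lemma powR_half_itv : 0 <= (2^-1 : R) `^ a < 1.
Proof.
rewrite powR_ge0/=.
have powa : 1 `^ a = 1 :> R by rewrite powR1.
have h1 : (2^-1 : R) < 1 by rewrite invf_lt1// ltr1n.
by rewrite -[ltRHS]powa; apply: gt0_ltr_powR; rewrite ?nnegrE ?invr_ge0.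
Qed.

Lemma tail_constant_ge0 u : 0 <= tail_constant u.
Proof.
have /andP[r0 r1] := powR_half_itv.
rewrite /tail_constant divr_ge0//; last by rewrite subr_ge0 ltW.
apply: divr_ge0; first by rewrite addr_ge0// powR_ge0.
by rewrite subr_ge0 ltW// cos1_lt1.
Qed.

(** 1 - exp(-J) <= J, and J of the step function scaled by u 2^-k decreases
geometrically in k since the exponents are at least a. *)
Lemma combination_tail k (theta : 'I_k -> R) (A : 'I_k -> set R) D u :
  (forall j, finite_lebesgue (A j)) -> finite_lebesgue D ->
  (forall x, `|step theta A x| <= \1_D x) -> 0 < u ->
  (P [set w | (u^-1 <= `|combination theta A w|)%R] <=
    (tail_constant u * fine (leb R D))%:E)%E.
Proof.
move=> fA fD sD u0.
have L0 : 0 <= fine (leb R D) by rewrite fine_ge0// measure_ge0.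
have U0 : 0 <= u `^ a + u `^ b by rewrite addr_ge0// powR_ge0.
apply: le_trans (@tail_le _ _ _ P (combination theta A) u
  ((u `^ a + u `^ b) * fine (leb R D)) (2^-1 `^ a)
  (measurable_combination theta A) u0 _ powR_half_itv _) _.
- exact: mulr_ge0.
- move=> k'.
  pose th := fun j => u / 2 ^+ k' * theta j.
  have -> : (fun w => cos (u / 2 ^+ k' * combination theta A w)) =
      (fun w => cos (combination th A w)).
    apply/funext => w; congr cos; rewrite mulr_sumr.
    by apply: eq_bigr => j _; rewrite mulrA.
  rewrite (multistable_charfun th fA).1.
  apply: (@le_trans _ _ (power_integral alpha (step th A))).
    by rewrite lerBlDl -lerBlDr (le_trans _ (expR_ge1Dx _)).
  rewrite mulrAC; apply: (power_integral_le a0 ea fA fD) => x.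
  have al0 : 0 < alpha x by exact: (exponent_gt0 a0 x ea).
  have -> : step th A x = u / 2 ^+ k' * step theta A x.
    by rewrite mulr_sumr; apply: eq_bigr => j _; rewrite mulrA.
  have := sD x; rewrite !indicE; case: (x \in D) => /=; last first.
    rewrite normr_le0 => /eqP->; rewrite mulr0 normr0 mulr0.
    by rewrite powR0// gt_eqF.
  move=> s1; rewrite mulr1.
  have p0 : 0 <= u / 2 ^+ k' by rewrite divr_ge0 ?exprn_ge0// ltW.
  apply: (@le_trans _ _ ((u / 2 ^+ k') `^ alpha x)).
    apply: ge0_ler_powR; rewrite ?nnegrE ?(ltW al0)// normrM (ger0_norm p0).
    by rewrite ler_piMr.
  rewrite powRM ?(ltW u0) ?invr_ge0 ?exprn_ge0//.
  apply: ler_pM; rewrite ?powR_ge0//.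
    by apply: (powR_le_add a0 (ltW u0)); case: ea.
  rewrite -powR_mulrn ?powR_ge0// -powRrM mulrC powRrM powR_mulrn ?invr_ge0//.
  rewrite exprVn; apply: ger_powR; last by have [_ /(_ x)/andP[]] := ea.
  have k1 : (1 : R) <= 2 ^+ k' by rewrite exprn_ege1// ler1n.
  by rewrite invr_gt0 (lt_le_trans ltr01 k1)/= invf_le1 ?(lt_le_trans ltr01 k1).
- by rewrite lee_fin /tail_constant -!mulrA (mulrC (fine _)) -!mulrA.
Qed.

(** The tail bound with an empty D: a combination whose step function vanishes
has characteristic function 1. *)
Lemma combination_eq0 k (theta : 'I_k -> R) (A : 'I_k -> set R) :
  (forall j, finite_lebesgue (A j)) -> (forall x, step theta A x = 0) ->
  {ae P, forall w, combination theta A w = 0}.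
Proof.
move=> fA s0; set Z := combination theta A.
pose N n := [set w | (n.+1%:R^-1 <= `|Z w|)%R].
have mN n : measurable (N n).
  rewrite /N -[X in measurable X]setTI; apply: (measurable_fun_le (f := cst _)) => //.
  by apply: measurableT_comp => //; exact: measurable_combination.
apply: (@negligibleS _ _ _ P (\bigcup_n N n)).
  move=> w /= /eqP; rewrite -normr_gt0 => Zw.
  exists (Num.bound `|Z w|^-1) => //; rewrite /N/= -[leRHS]invrK lef_pV2 ?posrE ?invr_gt0//.
  apply: (@le_trans _ _ (Num.bound `|Z w|^-1)%:R); last by rewrite ler_nat.
  by apply/ltW/archi_boundP; rewrite invr_ge0.
apply: negligible_bigcup => n; apply/negligibleP; first exact: mN.
apply/eqP; rewrite -measure_le0.
have := @combination_tail k theta A set0 n.+1%:R fA finite_lebesgue0 _ _.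
rewrite measure0 mulr0; apply => //.
by move=> x; rewrite s0 normr0 indicE.
Qed.

Lemma multistable_setU A B : finite_lebesgue A -> finite_lebesgue B ->
  A `&` B = set0 -> {ae P, forall w, M (A `|` B) w = M A w + M B w}.
Proof.
move=> fA fB AB0.
have fAB : finite_lebesgue (A `|` B).
  move: fA fB => [mA Aoo] [mB Boo]; split; first exact: measurableU.
  by rewrite measureU//; exact: lte_add_pinfty.
pose th (j : 'I_3) : R := nth 0 [:: 1; -1; -1] j.
pose S (j : 'I_3) : set R := nth set0 [:: A `|` B; A; B] j.
have fS j : finite_lebesgue (S j) by case: j => [[|[|[|]]]].
have s0 x : step th S x = 0.
  rewrite /step !big_ord_recl big_ord0 /th /S /= !indicE in_setU.
  have [xA|xA] := boolP (x \in A); have [xB|xB] := boolP (x \in B) => /=; try by ring.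
  by exfalso; move: xA xB; rewrite !inE => xA xB; rewrite -[False]/(set0 x) -AB0.
have := combination_eq0 fS s0; apply: filterS => w.
rewrite /combination !big_ord_recl big_ord0 /th /S /= => Z0.
by apply/eqP; rewrite -subr_eq0; apply/eqP; rewrite -Z0; ring.
Qed.

(** J is additive on step functions with disjoint supports and insensitive to
signs, so the characteristic functions of the sum and of the difference of the
two combinations are both the product of their characteristic functions. *)
Lemma trig_uncorrelated_disjoint p (t : 'I_p -> R) (A : 'I_p -> set R)
    q (u : 'I_q -> R) (B : 'I_q -> set R) :
  (forall i, finite_lebesgue (A i)) -> (forall k, finite_lebesgue (B k)) ->
  (forall i k, A i `&` B k = set0) ->
  trig_uncorrelated P (combination t A) (combination u B).
Proof.
move=> fA fB AB0.
have st0 x : step t A x * step u B x = 0.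
  have [sA|sA] := pselect (step t A x = 0); first by rewrite sA mul0r.
  rewrite [X in _ * X]big1 ?mulr0// => k _.
  rewrite indicE memNset ?mulr0// => Bx.
  apply: sA; apply: big1 => i _; rewrite indicE memNset ?mulr0// => Ax.
  by rewrite -[False]/(set0 x) -(AB0 i k).
apply: trig_uncorrelatedP.
- exact: measurable_combination.
- exact: measurable_combination.
- exact: (multistable_charfun t fA).2.
- exact: (multistable_charfun u fB).2.
move=> c c1.
pose S (i : 'I_(p + q)) := match fintype.split i with inl i => A i | inr k => B k end.
pose th (i : 'I_(p + q)) :=
  match fintype.split i with inl i => t i | inr k => c * u k end.
have fS i : finite_lebesgue (S i) by rewrite /S; case: fintype.split.
have Sl i : S (lshift q i) = A i by rewrite /S (unsplitK (inl i : 'I_p + 'I_q)).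
have Sr k : S (rshift p k) = B k by rewrite /S (unsplitK (inr k : 'I_p + 'I_q)).
have tl i : th (lshift q i) = t i by rewrite /th (unsplitK (inl i : 'I_p + 'I_q)).
have tr k : th (rshift p k) = c * u k by rewrite /th (unsplitK (inr k : 'I_p + 'I_q)).
have -> : (fun w => sin (combination t A w + c * combination u B w)) =
    (fun w => sin (combination th S w)).
  apply/funext => w; congr sin; rewrite [RHS]big_split_ord/=; congr (_ + _).
    by apply: eq_bigr => i _; rewrite Sl tl.
  by rewrite mulr_sumr; apply: eq_bigr => i _; rewrite Sr tr mulrA.
have -> : (fun w => cos (combination t A w + c * combination u B w)) =
    (fun w => cos (combination th S w)).
  apply/funext => w; congr cos; rewrite [RHS]big_split_ord/=; congr (_ + _).
    by apply: eq_bigr => i _; rewrite Sl tl.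
  by rewrite mulr_sumr; apply: eq_bigr => i _; rewrite Sr tr mulrA.
split; first exact: (multistable_charfun th fS).2.
rewrite (multistable_charfun th fS).1 (multistable_charfun t fA).1
  (multistable_charfun u fB).1 -expRD -opprD.
congr (expR (- _)).
pose cu k := c * u k.
have -> : step th S = (fun x => step t A x + step cu B x).
  apply/funext => x; rewrite [LHS]big_split_ord/=; congr (_ + _).
    by apply: eq_bigr => i _; rewrite Sl tl.
  by apply: eq_bigr => i _; rewrite Sr tr.
have cuE x : step cu B x = c * step u B x.
  by rewrite mulr_sumr; apply: eq_bigr => i _; rewrite mulrA.
rewrite (power_integral_disjoint a0 ea); last first.
- by move=> x; rewrite cuE mulrCA st0 mulr0.
- exact: (integrable_power_step a0 cu ea fB).
- exact: (integrable_power_step a0 t ea fA).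
suff -> : power_integral alpha (step cu B) = power_integral alpha (step u B) by [].
apply: eq_Rintegral => x _.
by rewrite cuE normrM; case: c1 => ->; rewrite ?normrN normr1 mul1r.
Qed.

Lemma indep_disjoint (B : set R) : measurable (B : set (lebesgueType R)) ->
  forall E F,
  generated_sigma finite_lebesgue (restrict_measure M B) E ->
  generated_sigma finite_lebesgue (restrict_measure M (~` B)) F ->
  indep_events P E F.
Proof.
move=> mB; apply: indep_generated => p f q g t u Df Dg.
apply: trig_uncorrelated_disjoint.
- by move=> i; apply: finite_lebesgueI.
- by move=> k; apply: finite_lebesgueI => //; exact: measurableC.
- by move=> i k; rewrite setIACA setICr setI0.
Qed.

End multistable.

(** * Almost sure countable additivity *)

Section countable_additivity.
Context {R : realType} (a b : R) (alpha : R -> R)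
  d (Omega : measurableType d) (P : probability Omega R)
  (I : (R -> R) -> {RV P >-> R}).
Hypotheses (a0 : 0 < a) (ea : exponent a b alpha)
  (hI : is_multistable_integral alpha I).

Local Notation M := (multistable_measure I).

Definition large (e : R) (A : set R) : set Omega := [set w | e <= `|M A w|].

Lemma largeE e A : large e A = M A @^-1` [set x | e <= `|x|].
Proof. by []. Qed.

Lemma measurable_norm_ge (e : R) : measurable [set x : R | e <= `|x|].
Proof.
rewrite -[X in measurable X]setTI; apply: (measurable_fun_le (f := cst _)) => //.
Qed.

Lemma measurable_large e A : measurable (large e A).
Proof.
rewrite largeE -[X in measurable X]setTI; apply: measurable_funP => //.
exact: measurable_norm_ge.
Qed.

Lemma large_tail A e : finite_lebesgue A -> 0 < e ->
  (P (large e A) <= (tail_constant a b e^-1 * fine (leb R A))%:E)%E.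
Proof.
move=> fA e0.
have sA x : `|step (fun=> 1) (fun _ : 'I_1 => A) x| <= \1_A x.
  by rewrite /step big_ord_recl big_ord0 addr0 mul1r ger0_norm.
have := combination_tail a0 ea hI (fun=> fA) fA sA (u := e^-1).
rewrite invr_gt0 invrK => /(_ e0); congr (P _ <= _)%E.
apply/funext => w /=.
by rewrite /combination big_ord_recl big_ord0 addr0 mul1r.
Qed.

Lemma generated_restrict B A S : finite_lebesgue A -> measurable S ->
  generated_sigma finite_lebesgue (restrict_measure M B) (M (A `&` B) @^-1` S).
Proof. by move=> fA mS; apply: sub_sigma_algebra; exists A => //; exists S. Qed.

Section generated_closure.
Variable X : set R -> {RV P >-> R}.
Local Notation G := (generated_sigma finite_lebesgue X).

Lemma generated_set0 : G set0.
Proof. by case: (@smallest_sigma_algebra _ setT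
  [set X j @^-1` B | j in finite_lebesgue & B in (measurable : set (set R))]). Qed.

Lemma generated_setC E : G E -> G (~` E).
Proof.
case: (@smallest_sigma_algebra _ setT
  [set X j @^-1` B | j in finite_lebesgue & B in (measurable : set (set R))]).
by move=> _ GC _ /GC; rewrite setTD.
Qed.

Lemma generated_setU E F : G E -> G F -> G (E `|` F).
Proof.
case: (@smallest_sigma_algebra _ setT
  [set X j @^-1` B | j in finite_lebesgue & B in (measurable : set (set R))]).
move=> G0 _ GU GE GF; rewrite -bigcup2E; apply: GU => -[|[|n]] //.
Qed.

Lemma generated_setD E F : G E -> G F -> G (E `\` F).
Proof.
move=> GE GF; rewrite setDE -[E]setCK -setCU; apply: generated_setC.
by apply: generated_setU => //; exact: generated_setC.
Qed.

End generated_closure.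

Lemma prob_le_ae (A B : set Omega) : measurable A -> measurable B ->
  {ae P, forall w, A w -> B w} -> (P A <= P B)%E.
Proof.
move=> mA mB [N [mN N0 AB]].
rewrite -[leRHS]adde0 -[X in (_ + X)%E]N0.
apply: le_trans (measureU2 _ mB mN).
apply: le_measure; rewrite ?inE//; first exact: measurableU.
move=> w Aw; have [Bw|Bw] := pselect (B w); [by left|right].
by apply: AB => /= H; apply/Bw/H.
Qed.

Lemma multistable_split B C : finite_lebesgue C ->
  measurable (B : set (lebesgueType R)) -> B `<=` C ->
  {ae P, forall w, M C w = M B w + M (C `\` B) w}.
Proof.
move=> fC mB BC; have fB := finite_lebesgue_sub mB BC fC.
have fD := finite_lebesgueD fC mB.
have := multistable_setU a0 ea hI fB fD; rewrite setDIK => /(_ erefl).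
by rewrite setDUK.
Qed.

Fixpoint some_large (e : R) (C : nat -> set R) (n : nat) : set Omega :=
  if n is n'.+1 then some_large e C n' `|` large e (C n') else set0.

Lemma some_largeP e C n w :
  some_large e C n w <-> exists2 j, (j < n)%N & large e (C j) w.
Proof.
elim: n => [|n IH] /=; first by split => // -[].
split=> [[/IH[j jn]|]|[j]].
- by exists j => //; exact: ltnW.
- by exists n.
- rewrite ltnS leq_eqVlt => /orP[/eqP->|jn jw]; first by right.
  by left; apply/IH; exists j.
Qed.

Lemma measurable_some_large e C n : measurable (some_large e C n).
Proof.
by elim: n => [|n IH] //=; apply: measurableU => //; exact: measurable_large.
Qed.

(** On the event that |M (C_ j)| >= 2e for some j, the increment M (C \ C_ j) is
independent of what happens inside C_ j and is smaller than e with probability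
at least 1/2, in which case |M C| >= e.  The induction on n compares the
probability of the event with that of its intersection with |M C| >= e, so that
the new part F of the event, disjoint from the former one, can be added. *)
Lemma ottaviani e (C_ : nat -> set R) (C : set R) : 0 < e ->
  (forall j, measurable (C_ j : set (lebesgueType R))) ->
  {homo C_ : i j / (i <= j)%N >-> i `<=` j} ->
  (forall j, C_ j `<=` C) -> finite_lebesgue C ->
  (forall j, (P (large e (C `\` C_ j)) <= (2^-1)%:E)%E) ->
  forall n, (P (some_large (2 * e) C_ n) <= 2%:E * P (large e C))%E.
Proof.
move=> e0 mC ndC CC fC Phalf n.
have fC_ j := finite_lebesgue_sub (mC j) (CC j) fC.
have mU := measurable_some_large (2 * e) C_; have mH := measurable_large e C.
suff H : (P (some_large (2 * e) C_ n) <=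
    2%:E * P (some_large (2 * e) C_ n `&` large e C))%E.
  apply: le_trans H _; rewrite lee_pmul2l// le_measure ?inE//.
  exact: measurableI.
elim: n => [|n IH] /=; first by rewrite set0I measure0 mule0.
set U := some_large _ _ n in IH *; set F := large (2 * e) (C_ n) `\` U.
set G := ~` large e (C `\` C_ n).
have mF : measurable F.
  by apply: measurableD; [exact: measurable_large|exact: mU].
have mG : measurable G by apply: measurableC; exact: measurable_large.
have UF : U `|` large (2 * e) (C_ n) = U `|` F by rewrite /F setUDr setDv setD0.
have UF0 : U `&` F = set0 by rewrite /F setIDA setIC -setIDA setDv setI0.
have gF : generated_sigma finite_lebesgue (restrict_measure M (C_ n)) F.
  have gL j : (j <= n)%N -> generated_sigma finite_lebesgue
      (restrict_measure M (C_ n)) (large (2 * e) (C_ j)).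
    move=> jn; rewrite largeE -(setIidl (ndC _ _ jn)).
    by apply: generated_restrict => //; exact: measurable_norm_ge.
  have gU k : (k <= n)%N -> generated_sigma finite_lebesgue
      (restrict_measure M (C_ n)) (some_large (2 * e) C_ k).
    elim: k => [|k IHk] kn; first exact: generated_set0.
    apply: generated_setU; first by apply: IHk; exact: ltnW.
    by apply: gL; exact: ltnW.
  by apply: generated_setD; [exact: gL|exact: gU].
have gG : generated_sigma finite_lebesgue (restrict_measure M (~` C_ n)) G.
  apply: generated_setC; rewrite largeE setDE.
  by apply: generated_restrict => //; exact: measurable_norm_ge.
have iFG := indep_disjoint a0 ea hI (mC n) gF gG.
have PG : ((2^-1)%:E <= P G)%E.
  rewrite probability_setC; last exact: measurable_large.
  have := Phalf n; have := fin_num_measure P _ (measurable_large e (C `\` C_ n)).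
  case: (P _) => // r _; rewrite -EFinB !lee_fin => r2.
  by rewrite lerBrDr -lerBrDl (le_trans r2)// {2}(splitr 1) div1r addrK.
have PF : (P F <= 2%:E * P (F `&` large e C))%E.
  have PFG : (P (F `&` G) <= P (F `&` large e C))%E.
    apply: prob_le_ae; [exact: measurableI|exact: measurableI|].
    have := multistable_split fC (mC n) (CC n); apply: filterS => w MC [Fw Gw].
    split=> //; case: Fw => + _; rewrite /large /= MC => F2.
    move: Gw => /negP; rewrite -ltNge => G1.
    have := ler_normB (M (C_ n) w + M (C `\` C_ n) w) (M (C `\` C_ n) w).
    rewrite addrK => N1; lra.
  apply: (@le_trans _ _ (2%:E * P (F `&` G))%E); last by rewrite lee_pmul2l.
  rewrite iFG muleCA -[leLHS]mule1 lee_wpmul2l//.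
  apply: (@le_trans _ _ (2%:E * (2^-1)%:E)%E); last by rewrite lee_pmul2l.
  by rewrite -EFinM mulfV.
have mUH : measurable (U `&` large e C) by apply: measurableI; [exact: mU|].
have mFH : measurable (F `&` large e C) by exact: measurableI.
have UFH0 : (U `&` large e C) `&` (F `&` large e C) = set0.
  by rewrite setIACA UF0 set0I.
rewrite UF setIUl (measureU _ (mU n) mF UF0) (measureU _ mUH mFH UFH0).
by rewrite ge0_muleDr// leeD.
Qed.

Lemma limit_measure_le (F : nat -> set Omega) (x : R) :
  (forall n, measurable (F n)) -> {homo F : i j / (i <= j)%N >-> i `<=` j} ->
  (forall n, (P (F n) <= x%:E)%E) -> (P (\bigcup_n F n) <= x%:E)%E.
Proof.
move=> mF ndF Fx.
have cF : P (F n) @[n --> \oo] --> P (\bigcup_n F n).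
  apply: nondecreasing_cvg_mu => //; first exact: bigcup_measurable.
  by move=> i j ij; apply/subsetPset; exact: ndF.
rewrite -(cvg_lim _ cF)//; apply: lime_le; first by apply/cvg_ex; eexists; exact: cF.
exact: nearW.
Qed.

(** The maximal inequality for the increasing sets D n, ..., D 1, D 0, followed
by a passage to the limit in n. *)
Lemma sup_large_le (D : nat -> set R) e : 0 < e ->
  (forall n, finite_lebesgue (D n)) ->
  {homo D : i j / (i <= j)%N >-> j `<=` i} ->
  tail_constant a b e^-1 * fine (leb R (D 0%N)) <= 2^-1 ->
  (P (\bigcup_n large (2 * e) (D n)) <=
    (2 * (tail_constant a b e^-1 * fine (leb R (D 0%N))))%:E)%E.
Proof.
move=> e0 fD niD half.
pose F n := \bigcup_(i in [set i | (i <= n)%N]) large (2 * e) (D i).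
have mF n : measurable (F n).
  by apply: bigcup_measurable => i _; exact: measurable_large.
rewrite (_ : \bigcup_n large (2 * e) (D n) = \bigcup_n F n); last first.
  apply/seteqP; split => [w [n _ wn]|w [n _ [i _ wi]]]; last by exists i.
  by exists n => //; exists n => /=.
apply: limit_measure_le => [//|i j ij w [k ki wk]|n].
  by exists k => //=; exact: leq_trans ij.
(* the sequence is read backwards, from the smallest set to the largest *)
pose C_ j := D (n - j)%N.
have lD A : finite_lebesgue A -> A `<=` D 0%N ->
    fine (leb R A) <= fine (leb R (D 0%N)).
  move=> [mA Aoo] AD; have [mD Doo] := fD 0%N.
  by rewrite fine_le ?ge0_fin_numE// le_measure ?inE.
have lt A : finite_lebesgue A -> A `<=` D 0%N -> (P (large e A) <=
    (tail_constant a b e^-1 * fine (leb R (D 0%N)))%:E)%E.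
  move=> fA AD; apply: le_trans (large_tail fA e0) _.
  by rewrite lee_fin ler_wpM2l ?tail_constant_ge0// lD.
have mC j : measurable (C_ j : set (lebesgueType R)) by case: (fD (n - j)%N).
apply: (@le_trans _ _ (P (some_large (2 * e) C_ n.+1))).
  apply: le_measure; rewrite ?inE//; first exact: measurable_some_large.
  move=> w [i /= ni wi]; apply/(some_largeP _ _ n.+1); exists (n - i)%N.
    by rewrite ltnS leq_subr.
  by rewrite /C_ subKn.
apply: le_trans (@ottaviani e C_ (D 0%N) e0 mC _ _ (fD 0%N) _ n.+1) _.
- by move=> i j ij; apply: niD; exact: leq_sub2l.
- by move=> j; exact: niD.
- move=> j; apply: le_trans (lt _ _ _) _; last by rewrite lee_fin.
    exact: finite_lebesgueD.
  exact: subDsetl.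
- by rewrite EFinM lee_pmul2l// lt.
Qed.

(** For each threshold, the probability that it is exceeded infinitely often is
below every bound of the maximal inequality for a tail of the sequence. *)
Lemma multistable_cvg0 (D : nat -> set R) :
  (forall n, finite_lebesgue (D n)) ->
  {homo D : i j / (i <= j)%N >-> j `<=` i} -> \bigcap_n D n = set0 ->
  {ae P, forall w, M (D n) w @[n --> \oo] --> 0}.
Proof.
move=> fD niD D0.
have lD : fine (leb R (D n)) @[n --> \oo] --> 0.
  have : (leb R (D n) @[n --> \oo] --> leb R (\bigcap_n D n))%E.
    apply: nonincreasing_cvg_mu.
    - by case: (fD 0%N).
    - by move=> n; case: (fD n).
    - by apply: bigcap_measurable => // n _; case: (fD n).
    - by move=> i j ij; apply/subsetPset; exact: niD.
  by rewrite D0 measure0 => /fine_cvg.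
pose E e q0 := \bigcup_n large (2 * e) (D (q0 + n)%N).
have mE e q0 : measurable (E e q0).
  by apply: bigcup_measurable => n _; exact: measurable_large.
pose N k := \bigcap_q0 E k.+1%:R^-1 q0.
have N0 k : P (N k) = 0%E.
  set e : R := k.+1%:R^-1; have e0 : 0 < e by rewrite invr_gt0.
  set t := tail_constant a b e^-1.
  have t0 : 0 <= t by exact: (tail_constant_ge0 b a0).
  apply/eqP; rewrite -measure_le0; apply/lee_addgt0Pr => r r0; rewrite add0e.
  have tl : t * fine (leb R (D n)) @[n --> \oo] --> 0.
    by rewrite -(mulr0 t); apply: cvgM => //; exact: cvg_cst.
  have c0 : 0 < Num.min (2^-1) (r / 2) by rewrite lt_min invr_gt0 ltr0n divr_gt0.
  have /cvgr0Pnorm_le/(_ _ c0)[q _ Hq] := tl.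
  have tD : 0 <= t * fine (leb R (D q)).
    by apply: mulr_ge0 => //; rewrite fine_ge0// measure_ge0.
  have := Hq q (leqnn q); rewrite (ger0_norm tD) le_min => /andP[h1 h2].
  apply: (@le_trans _ _ (P (E e q))).
    apply: le_measure; rewrite ?inE//; last by move=> w Nw; exact: Nw.
    exact: bigcap_measurable.
  apply: le_trans (@sup_large_le (fun n => D (q + n)%N) e e0 _ _ _) _.
  - by move=> n; exact: fD.
  - by move=> i j ij; apply: niD; rewrite leq_add2l.
  - by rewrite addn0.
  - by rewrite lee_fin addn0 mulrC -ler_pdivlMr.
apply: (@negligibleS _ _ _ P (\bigcup_k N k)); last first.
  apply: negligible_bigcup => k; apply/negligibleP; last exact: N0.
  by apply: bigcap_measurable.
move=> w /= H; apply: contrapT => nN; apply: H.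
apply/cvgr0Pnorm_lt => r r0.
(* thresholds have the form 2 / (k + 1), so k + 1 >= 2 / r is needed *)
pose k := Num.bound (2 / r).
have [q nE] : exists q, ~ E k.+1%:R^-1 q w.
  by apply/existsNP => H; apply: nN; exists k => // q _; exact: H.
exists q => // n /= qn; rewrite ltNge; apply/negP => rn; apply: nE.
exists (n - q)%N => //; rewrite /large /= subnKC//; apply: le_trans rn.
rewrite ler_pdivrMr ?ltr0n// mulrC -ler_pdivrMr//.
apply: (@le_trans _ _ k%:R); last by rewrite ler_nat.
by apply/ltW/archi_boundP; rewrite divr_ge0// ltW.
Qed.

(** The remainder of the series is M (D n) by finite additivity. *)
Theorem multistable_countably_additive (A_ : nat -> set R)
    (A : set R) : finite_lebesgue A ->
  (forall k, measurable (A_ k : set (lebesgueType R))) ->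
  trivIset setT A_ -> \bigcup_k A_ k = A ->
  {ae P, forall w, \sum_(0 <= k < n) M (A_ k) w @[n --> \oo] --> M A w}.
Proof.
move=> fA mA tA AU.
pose D n := A `\` \bigcup_(k in [set k | (k < n)%N]) A_ k.
have fD n : finite_lebesgue (D n).
  by apply: finite_lebesgueD => //; apply: bigcup_measurable.
have niD : {homo D : i j / (i <= j)%N >-> j `<=` i}.
  by move=> i j ij; apply: setDS => x [k ki xk]; exists k => //=; exact: leq_trans ij.
have D0 : \bigcap_n D n = set0.
  apply/seteqP; split => // x Dx; have [+ _] := Dx 0%N Logic.I.
  rewrite -AU => -[k _ xk]; have [_] := Dx k.+1 Logic.I; apply.
  by exists k => /=.
have DS n : D n.+1 = D n `\` A_ n.
  rewrite /D setDDl; congr (_ `\` _); apply/seteqP; split => x.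
    move=> [k /=]; rewrite ltnS leq_eqVlt => /orP[/eqP->|kn] xk; first by right.
    by left; exists k.
  by move=> [[k /= kn xk]|xn]; [exists k => //=; exact: ltnW|exists n => /=].
have AD n : A_ n `<=` D n.
  move=> x xn; split; first by rewrite -AU; exists n.
  move=> [k /= kn xk]; have := tA n k Logic.I Logic.I (ex_intro _ x (conj xn xk)) => nk.
  by rewrite nk ltnn in kn.
have rec : {ae P, forall w, forall n, M (D n) w = M (A_ n) w + M (D n.+1) w}.
  apply: ae_foralln => n; rewrite DS; exact: multistable_split.
have := multistable_cvg0 fD niD D0; apply: filterS2 rec => w Dw D0w.
have sumE n : \sum_(0 <= k < n) M (A_ k) w = M A w - M (D n) w.
  elim: n => [|n IH].
    rewrite big_geq//; have -> : D 0%N = A.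
      by rewrite /D (_ : bigcup _ _ = set0) ?setD0//; apply/seteqP; split => // x [].
    by rewrite subrr.
  by rewrite big_nat_recr//= IH Dw; ring.
under eq_fun do rewrite sumE.
have : M A w - M (D n) w @[n --> \oo] --> M A w - 0.
  by apply: cvgB D0w; exact: cvg_cst.
by rewrite subr0.
Qed.

End countable_additivity.

(** * Dyadic intervals and piecewise constant exponents *)

Section dyadic.
Context {R : realType}.

Lemma borel_lebesgue (A : set R) : measurable A ->
  measurable (A : set (lebesgueType R)).
Proof. by move=> mA; apply: sub_caratheodory. Qed.

Lemma borel_fun_lebesgue (f : R -> R) : measurable_fun [set: R] f ->
  measurable_fun [set: lebesgueType R] (f : lebesgueType R -> R).
Proof. by move=> mf _ B mB; apply: borel_lebesgue; exact: mf. Qed.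

Definition dyadic_index (n : nat) (x : R) : int := Num.floor (x * 2 ^+ n).

Lemma dyadic_intervalP n r (x : R) :
  dyadic_interval n r x <-> dyadic_index n x = r.
Proof.
have p0 : (0 : R) < 2 ^+ n by exact: exprn_gt0.
rewrite /dyadic_interval /= ler_pdivrMr// ltr_pdivlMr//; split.
  exact: floor_def.
by move=> <-; exact: floor_itv.
Qed.

Lemma measurable_dyadic n r : measurable (dyadic_interval n r : set R).
Proof.
rewrite (_ : dyadic_interval n r = `[r%:~R / 2 ^+ n, (r + 1)%:~R / 2 ^+ n[%classic).
  exact: measurable_itv.
by apply/seteqP; split => x; rewrite /dyadic_interval /= in_itv.
Qed.

Lemma dyadic_disjoint n (r s : int) : r != s ->
  dyadic_interval n r `&` dyadic_interval n s = set0 :> set R.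
Proof.
move=> rs; apply/seteqP; split => // x [/dyadic_intervalP rx /dyadic_intervalP sx].
by move/eqP: rs; apply; rewrite -rx.
Qed.

(** A closed form on the whole line of an exponent prescribed interval by
interval, from which measurability and convergence are read off. *)
Lemma dyadic_exponentE (alpha : R -> R) alphan n :
  (forall r x, dyadic_interval n r x -> alphan x = alpha (r%:~R / 2 ^+ n)) ->
  alphan =1 fun x => alpha ((dyadic_index n x)%:~R / 2 ^+ n).
Proof. by move=> H x; apply: H; apply/dyadic_intervalP. Qed.

Lemma dyadic_cvg (x : R) : (dyadic_index n x)%:~R / 2 ^+ n @[n --> \oo] --> x.
Proof.
apply/cvgrPdist_le => e e0; near=> n.
have p0 : (0 : R) < 2 ^+ n by exact: exprn_gt0.
have /andP[h1 h2] := floor_itv (x * 2 ^+ n).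
rewrite -/(dyadic_index n x) in h1 h2.
rewrite ger0_norm; last by rewrite subr_ge0 ler_pdivrMr.
rewrite -[X in X - _](mulfK (lt0r_neq0 p0)) -mulrBl ler_pdivrMr//.
apply: (@le_trans _ _ 1); first by rewrite lerBlDr addrC -(intrD _ _ 1) ltW.
rewrite mulrC -ler_pdivrMr// div1r; apply: (@le_trans _ _ n%:R).
  by near: n; exact: nbhs_infty_ger.
by rewrite -natrX ler_nat ltnW// ltn_expl.
Unshelve. all: by end_near. Qed.

Lemma measurable_dyadic_exponent n (alpha : R -> R) : continuous alpha ->
  measurable_fun [set: R] (fun x : R => alpha ((dyadic_index n x)%:~R / 2 ^+ n)).
Proof.
move=> ca; apply: (measurableT_comp (continuous_measurable_fun ca)).
apply: measurable_funM; last exact: measurable_cst.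
apply: nondecreasing_measurable => // x y xy.
by rewrite ler_int; apply: le_floor; rewrite ler_wpM2r// exprn_ge0.
Qed.

End dyadic.

Section dominated_power.
Context {R : realType} (a b : R).
Hypothesis a0 : 0 < a.

Lemma power_integral_cvg (alphan : nat -> R -> R) (alpha : R -> R)
    k (theta : 'I_k -> R) (A : 'I_k -> set R) :
  (forall n, exponent a b (alphan n)) -> exponent a b alpha ->
  (forall x, alphan n x @[n --> \oo] --> alpha x) ->
  (forall j, finite_lebesgue (A j)) ->
  power_integral (alphan n) (step theta A) @[n --> \oo] -->
  power_integral alpha (step theta A).
Proof.
move=> en e cv fA; apply: fine_cvg.
pose c := (\sum_j `|theta j|) `^ a + (\sum_j `|theta j|) `^ b.
have ms := measurable_step theta fA.
have [] := @dominated_convergence _ (lebesgueType R) R (leb R) setT measurableT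
  (fun n x => (`|step theta A x| `^ alphan n x)%:E)
  (fun x => (`|step theta A x| `^ alpha x)%:E)
  (fun x => (c * \sum_j \1_(A j) x)%:E).
- move=> n; apply/(@measurable_EFinP _ (lebesgueType R)).
  exact: measurable_power (en n) ms.
- by apply/(@measurable_EFinP _ (lebesgueType R)); exact: measurable_power e ms.
- apply/aeW => x _; apply: cvg_EFin; first exact: nearW.
  rewrite (powR_posE _ (exponent_gt0 a0 x e)).
  under eq_fun do rewrite (powR_posE _ (exponent_gt0 a0 x (en _))).
  apply: cvgM; first exact: cvg_cst.
  apply: continuous_cvg; first exact: continuous_expR.
  by apply: cvgM; [exact: cv|exact: cvg_cst].
- exact: integrable_sum_indic.
- apply/aeW => x n _; rewrite lee_fin ger0_norm ?powR_ge0//.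
  exact: (power_step_bound a0).
move=> _ _; rewrite fineK//.
exact: integrable_fin_num (integrable_power_step a0 theta e fA).
Qed.

End dominated_power.

(** * Convergence of multistable measures *)

Section dyadic_decomposition.
Context {R : realType} (a b : R) (alpha : R -> R)
  d (Omega : measurableType d) (P : probability Omega R)
  (I : (R -> R) -> {RV P >-> R}) (n : nat).
Hypotheses (a0 : 0 < a) (ea : exponent a b alpha)
  (hI : is_multistable_integral alpha I).

Local Notation M := (multistable_measure I).
Local Notation Mr r := (restrict_measure M (dyadic_interval n r)).

(** The values of M on subsets of another dyadic interval are values of M on
subsets of the complement. *)
Lemma generated_dyadic_compl (r s : int) : r != s ->
  generated_sigma finite_lebesgue (Mr s) `<=`
  generated_sigma finite_lebesgue (restrict_measure M (~` dyadic_interval n r)).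
Proof.
move=> rs; apply: smallest_sub; first exact: smallest_sigma_algebra.
have sr : (dyadic_interval n s : set R) `<=` ~` dyadic_interval n r.
  by move=> x sx rx; rewrite -[False]/((set0 : set R) x) -(@dyadic_disjoint R n r s).
move=> _ [A fA [B mB <-]]; apply: sub_sigma_algebra.
exists (A `&` dyadic_interval n s).
  by apply: finite_lebesgueI => //; exact: borel_lebesgue (measurable_dyadic _ _).
by exists B => //; rewrite /restrict_measure -setIA (setIidl sr).
Qed.

(** One event at a time is split off: the events attached to the other intervals
live in the sigma-algebra of the complement. *)
Lemma independent_dyadic : independent_measures (fun r : int => Mr r).
Proof.
move=> S E gE.
suff H (s : seq int) : uniq s ->
    (forall i, i \in s -> generated_sigma finite_lebesgue (Mr i) (E i)) ->
    P (\bigcap_(i in [set` s]) E i) = (\prod_(i <- s) P (E i))%E.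
  by apply: H => //; exact: fset_uniq.
elim: s => [|r s IH] /=.
  by move=> _ _; rewrite big_nil (_ : \bigcap_(i in _) _ = setT) ?probability_setT//;
    apply/seteqP; split.
move=> /andP[rs us] gs; rewrite big_cons -IH//; last first.
  by move=> i si; apply: gs; rewrite inE si orbT.
have -> : \bigcap_(i in [set` r :: s]) E i = E r `&` \bigcap_(i in [set` s]) E i.
  apply/seteqP; split => [x Ex|x [Er Es] i /=].
    split; first by apply: Ex; rewrite /= inE eqxx.
    by move=> i si; apply: Ex; rewrite /= inE [_ \in _]si orbT.
  by rewrite inE => /orP[/eqP->//|]; exact: Es.
apply: (indep_disjoint a0 ea hI (borel_lebesgue (measurable_dyadic n r))).
  by apply: gs; rewrite inE eqxx.
have {}gs i : i \in s -> generated_sigma finite_lebesgue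
    (restrict_measure M (~` dyadic_interval n r)) (E i).
  move=> si; apply: (@generated_dyadic_compl r i).
    by apply: contraNneq rs => ->.
  by apply: gs; rewrite inE si orbT.
elim: s {IH rs us} gs => [|i s IH] gs.
  rewrite (_ : \bigcap_(i in _) _ = ~` set0).
    by apply: generated_setC; exact: generated_set0.
  by rewrite setC0; apply/seteqP; split.
rewrite (_ : \bigcap_(i in _) _ = ~` (~` E i `|` ~` \bigcap_(i in [set` s]) E i)).
  apply: generated_setC; apply: generated_setU; apply: generated_setC.
    by apply: gs; rewrite inE eqxx.
  by apply: IH => j js; apply: gs; rewrite inE js orbT.
rewrite setCU !setCK; apply/seteqP; split => [x Ex|x [Er Es] j /=].
  split; first by apply: Ex; rewrite /= inE eqxx.
  by move=> j sj; apply: Ex; rewrite /= inE [_ \in _]sj orbT.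
by rewrite inE => /orP[/eqP->//|]; exact: Es.
Qed.

Lemma dyadic_half_series_cvg (A : set R) (rk : nat -> int) : injective rk ->
  finite_lebesgue A ->
  {ae P, forall w, \sum_(0 <= k < p) Mr (rk k) A w @[p --> \oo] -->
     M (A `&` \bigcup_k dyadic_interval n (rk k)) w}.
Proof.
move=> rki fA.
have mB k : measurable (dyadic_interval n (rk k) : set (lebesgueType R)).
  by exact: borel_lebesgue (measurable_dyadic _ _).
apply: (multistable_countably_additive a0 ea hI
  (A_ := fun k => A `&` dyadic_interval n (rk k))).
- by apply: finite_lebesgueI => //; apply: bigcupT_measurable.
- by move=> k; apply: measurableI => //; case: fA.
- apply/trivIsetP => i j _ _ ij.
  by rewrite setIACA dyadic_disjoint ?setI0// (inj_eq rki).
- by rewrite setI_bigcupr.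
Qed.

Lemma dyadic_series_cvg (A : set R) : finite_lebesgue A ->
  {ae P, forall w, zseries_cvg_to (fun r : int => Mr r A w) (M A w)}.
Proof.
move=> fA.
pose Bp : set R := \bigcup_(k : nat) dyadic_interval n k%:Z.
pose Bn : set R := \bigcup_(k : nat) dyadic_interval n (- (k.+1)%:Z).
have cp : {ae P, forall w, \sum_(0 <= k < p) Mr k%:Z A w @[p --> \oo] -->
     M (A `&` Bp) w}.
  by apply: (@dyadic_half_series_cvg A (fun k : nat => k%:Z)) => // i j [].
have cn : {ae P, forall w, \sum_(0 <= k < p) Mr (- (k.+1)%:Z) A w @[p --> \oo] -->
     M (A `&` Bn) w}.
  by apply: (@dyadic_half_series_cvg A (fun k : nat => - (k.+1)%:Z)) => // i j /oppr_inj[].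
have mBp : measurable (Bp : set (lebesgueType R)).
  by apply: bigcupT_measurable => k; exact: borel_lebesgue (measurable_dyadic _ _).
have mBn : measurable (Bn : set (lebesgueType R)).
  by apply: bigcupT_measurable => k; exact: borel_lebesgue (measurable_dyadic _ _).
have AE : (A `&` Bn) `|` (A `&` Bp) = A.
  rewrite -setIUr setIidl// => x _.
  have : dyadic_interval n (dyadic_index n x) x by apply/dyadic_intervalP.
  case: (dyadic_index n x) => k xk; first by right; exists k.
  by left; exists k => //; rewrite -NegzE.
have A0 : (A `&` Bn) `&` (A `&` Bp) = set0.
  rewrite setIACA; apply/seteqP; split => // x [_ [[i _ xi] [j _ xj]]].
  by rewrite -[set0 x]/((set0 : set R) x) -(@dyadic_disjoint _ n (- i.+1%:Z) j%:Z).
have := multistable_setU a0 ea hI (finite_lebesgueI fA mBn) (finite_lebesgueI fA mBp) A0.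
rewrite AE => add; near=> w.
have -> : M A w = M (A `&` Bn) w + M (A `&` Bp) w by near: w.
have Hn : \sum_(0 <= k < p) Mr (- (k.+1)%:Z) A w @[p --> \oo] -->
  M (A `&` Bn) w by near: w; exact: cn.
have Hp : \sum_(0 <= k < p) Mr k%:Z A w @[p --> \oo] -->
  M (A `&` Bp) w by near: w; exact: cp.
apply: cvgD; first exact: (cvg_comp _ _ cvg_fst Hn).
exact: (cvg_comp _ _ cvg_snd Hp).
Unshelve. all: by end_near. Qed.

End dyadic_decomposition.

(** * Convergence of the finite-dimensional distributions *)

(** For u <= 1 the exponent a dominates, and u is chosen so that u^a = v. *)
Lemma tail_constant_cvg0 {R : realType} (a b : R) : 0 < a -> a <= b ->
  forall e : R, 0 < e -> exists2 u : R, 0 < u & tail_constant a b u <= e.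
Proof.
move=> a0 ab e e0.
have kappa0 : 0 < 1 - cos (1 : R) by rewrite subr_gt0 cos1_lt1.
have rho0 : 0 < 1 - (2^-1 : R) `^ a.
  by rewrite subr_gt0; have /andP[] := powR_half_itv a0.
pose v := Num.min 1 (e * (1 - 2^-1 `^ a) * (1 - cos 1) / 2).
have v0 : 0 < v by rewrite lt_min ltr01/= divr_gt0// !mulr_gt0.
have v1 : v <= 1 by rewrite ge_min lexx.
exists (v `^ a^-1); first exact: powR_gt0.
have u1 : v `^ a^-1 <= 1.
  have powa : 1 `^ a^-1 = 1 :> R by rewrite powR1.
  rewrite -[leRHS]powa; apply: ge0_ler_powR; rewrite ?nnegrE ?invr_ge0 ?(ltW v0) ?(ltW a0)//.
have ua : (v `^ a^-1) `^ a = v.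
  by rewrite -powRrM mulVf ?gt_eqF// powRr1// ltW.
rewrite /tail_constant ler_pdivrMr// ler_pdivrMr//.
apply: (@le_trans _ _ (v + v)).
  rewrite ua lerD2l -[leRHS]ua; apply: ger_powR => //.
  by rewrite powR_gt0.
have : v <= e * (1 - 2^-1 `^ a) * (1 - cos 1) / 2 by rewrite ge_min lexx orbT.
by rewrite ler_pdivlMr// mulr_natr mulr2n.
Qed.

Section tightness.
Context {R : realType} (a b : R) (alpha : R -> R)
  d (Omega : measurableType d) (P : probability Omega R)
  (I : (R -> R) -> {RV P >-> R}).
Hypotheses (a0 : 0 < a) (ea : exponent a b alpha)
  (hI : is_multistable_integral alpha I).

Local Notation M := (multistable_measure I).

Definition measure_vector m (A : 'I_m -> set R) (w : Omega) : 'rV[R]_m :=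
  \row_(i < m) M (A i) w.

Lemma measure_vector_measurable m (A : 'I_m -> set R) :
  coord_measurable (measure_vector A).
Proof.
move=> j; rewrite (_ : (fun w => _) = M (A j)); first exact: measurable_funP.
by apply/funext => w; rewrite mxE.
Qed.

Lemma dot_measure_vector m (A : 'I_m -> set R) t :
  (fun w => dot t (measure_vector A w)) =
  combination I (fun j => t ord0 j) A.
Proof. by apply/funext => w; apply: eq_bigr => j _; rewrite mxE. Qed.

Lemma outside_measure_vector m (A : 'I_m -> set R) u :
  (forall i, finite_lebesgue (A i)) -> 0 < u ->
  fine (P (outside (measure_vector A) u^-1)) <=
  tail_constant a b u * \sum_i fine (leb R (A i)).
Proof.
move=> fA u0.
have mO : measurable (outside (measure_vector A) u^-1).
  exact: measurable_outside (measure_vector_measurable A).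
rewrite -lee_fin fineK ?fin_num_measure//.
apply: (@le_trans _ _ (\sum_i P (large I u^-1 (A i)))%E).
  apply: (@le_trans _ _ (P (\big[setU/set0]_i large I u^-1 (A i)))).
    apply: le_measure; rewrite ?inE//.
      by apply: bigsetU_measurable => i _; exact: measurable_large.
    move=> w [j]; rewrite mxE => /ltW uj; rewrite -bigcup_seq.
    by exists j; rewrite //= mem_index_enum.
  have [] // : measurable (\big[setU/set0]_i large I u^-1 (A i)) /\
      (P (\big[setU/set0]_i large I u^-1 (A i)) <=
      \sum_i P (large I u^-1 (A i)))%E.
  pose K (E : set Omega) x := measurable E /\ (P E <= x)%E.
  apply: (big_ind2 K); first by split; rewrite ?measure0.
    move=> E1 x1 E2 x2 [m1 le1] [m2 le2]; split; first exact: measurableU.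
    exact: le_trans (measureU2 _ m1 m2) (leeD le1 le2).
  by move=> i _; split => //; exact: measurable_large.
rewrite mulr_sumr -sumEFin; apply: lee_sum => i _.
have := large_tail a0 ea hI (fA i) (e := u^-1).
by rewrite invrK invr_gt0; exact.
Qed.

End tightness.

Theorem theorem2p6 (R : realType) (a b : R) (alpha : R -> R)
    (alphan : nat -> R -> R)
    (dn : nat -> measure_display) (Omegan : forall n, measurableType (dn n))
    (Pn : forall n, probability (Omegan n) R)
    (d : measure_display) (Omega : measurableType d) (P : probability Omega R)
    (In : forall n, (R -> R) -> {RV (Pn n) >-> R})
    (I : (R -> R) -> {RV P >-> R}) :
  0 < a -> a <= b -> b <= 2 ->
  (forall x, a <= alpha x <= b) -> continuous alpha ->
  (forall n (r : int) x, dyadic_interval n r x ->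
     alphan n x = alpha (r%:~R / 2 ^+ n)) ->
  (forall n, is_multistable_integral (alphan n) (In n)) ->
  is_multistable_integral alpha I ->
  (forall n : nat,
     independent_measures (fun r : int =>
       restrict_measure (multistable_measure (In n)) (dyadic_interval n r)) /\
     (forall A : set R, finite_lebesgue A ->
        {ae Pn n, forall w,
          zseries_cvg_to (fun r : int =>
            restrict_measure (multistable_measure (In n)) (dyadic_interval n r) A w)
            (multistable_measure (In n) A w)})) /\
  (forall (m : nat) (A : 'I_m -> set R), (forall i, finite_lebesgue (A i)) ->
     cvg_in_distribution Pn P
       (fun n w => \row_(i < m) multistable_measure (In n) (A i) w)
       (fun w => \row_(i < m) multistable_measure I (A i) w)).
Proof.
move=> a0 ab b2 alphaab ca halphan hIn hI.
have alphanE n := dyadic_exponentE (halphan n).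
have ea : exponent a b alpha.
  split=> //; apply: borel_fun_lebesgue; exact: continuous_measurable_fun.
have en n : exponent a b (alphan n).
  split; last by move=> x; rewrite alphanE.
  rewrite (funext (alphanE n)); apply: borel_fun_lebesgue.
  exact: measurable_dyadic_exponent.
split=> [n|m A fA].
  split; first exact: (independent_dyadic a0 (en n) (hIn n)).
  by move=> A fA; exact: (dyadic_series_cvg n a0 (en n) (hIn n)).
move=> g cg [C gC].
have mX := measure_vector_measurable I A.
have mXn n := measure_vector_measurable (In n) A.
have bg d' (T : measurableType d') (Q : probability T R) (X : T -> 'rV[R]_m) :
    coord_measurable X -> bounded_measurable (g \o X).
  by move=> mY; split; [exact: measurable_continuous mY cg gC|exists C => w; exact: gC].
rewrite (expectation_mean P (bg _ _ P _ mX)).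
under eq_fun do rewrite (expectation_mean (Pn _) (bg _ _ (Pn _) _ (mXn _))).
apply: cvg_EFin; first exact: nearW.
apply: (levy_continuity mXn mX) => //; last by exists C.
- move=> t; rewrite (_ : (fun n => _) = (fun n =>
    expR (- power_integral (alphan n) (step (fun j => t ord0 j) A)))); last first.
    apply/funext => n; have := (multistable_charfun a0 (en n) (hIn n) (fun j => t ord0 j) fA).1.
    by rewrite -dot_measure_vector.
  have := (multistable_charfun a0 ea hI (fun j => t ord0 j) fA).1.
  rewrite -dot_measure_vector => ->.
  apply: continuous_cvg; first exact: continuous_expR.
  apply: cvgN; apply: (power_integral_cvg a0 en ea) => // x.
  under eq_fun do rewrite alphanE.
  by apply: continuous_cvg; [exact: ca|exact: dyadic_cvg].
- move=> t; rewrite (_ : (fun n => _) = (fun n => 0)); last first.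
    apply/funext => n; have := (multistable_charfun a0 (en n) (hIn n) (fun j => t ord0 j) fA).2.
    by rewrite -dot_measure_vector.
  have := (multistable_charfun a0 ea hI (fun j => t ord0 j) fA).2.
  by rewrite -dot_measure_vector => ->; exact: cvg_cst.
- move=> e e0.
  pose S := \sum_i fine (leb R (A i)).
  have S0 : 0 <= S by apply: sumr_ge0 => i _; rewrite fine_ge0// measure_ge0.
  have e10 : 0 < e / (S + 1) by rewrite divr_gt0// ltr_wpDl.
  have [u u0 ue] := tail_constant_cvg0 a0 ab e10.
  have uS : tail_constant a b u * S <= e.
    apply: (@le_trans _ _ (e / (S + 1) * S)); first by rewrite ler_wpM2r.
    by rewrite mulrAC ler_pdivrMr ?ltr_wpDl// ler_wpM2l ?(ltW e0)// lerDl.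
  exists u^-1; first by rewrite invr_gt0.
  split=> [n|]; apply: le_trans uS.
    exact: (outside_measure_vector a0 (en n) (hIn n) fA u0).
  exact: (outside_measure_vector a0 ea hI fA u0).
Qed.
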